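(* The problem \textsc{Periodic Foremost-path TGR} can be solved in $\mathcal{O}(n^3\log n)$ time and $\mathcal{O}(n^2)$ space. Furthermore, if the instance is realizable, a realization with at most $n^2$ time labels within any period can be computed within the same time and space bounds.
   Context: A temporal graph $\mathcal{G}=(G,\lambda)$ consists of a static undirected graph $G=(V,E)$ with $V=[n]$ and a labeling $\lambda:E\to 2^{\mathbb{N}_{>0}}$ assigning to each edge the set of positive times at which it appears. It is $\Delta$-periodic ($\Delta\in\mathbb{N}_{>0}$) if for each edge $e$, $\tau\in\lambda(e)$ if and only if $\tau \bmod \Delta\in\lambda(e)$; such a temporal graph is represented by its temporal edges up to time $\Delta$. A strict temporal $uv$-path is a path $u=v_0,\dots,v_k=v$ in $G$ with distinct vertices and times $\tau_1<\dots<\tau_k$, $\tau_i\in\lambda(\{v_{i-1},v_i\})$; its arrival time is $\tau_k$. $\mathrm{Fo}(\mathcal{G})$ is the $n\times n$ matrix with diagonal $0$ and entry $(u,v)$, $u\ne v$, the minimum arrival time of a strict temporal $uv$-path ($\infty$ if none). A distance matrix is an $n\times n$ matrix with entries in $\mathbb{N}\cup\{\infty\}$, zero exactly on the diagonal. \textsc{Periodic Foremost-path TGR}: given $n$, an $n\times n$ distance matrix $D$ and a period $\Delta$, decide whether there exists a $\Delta$-periodic temporal graph $\mathcal{G}$ on $[n]$ with $\mathrm{Fo}(\mathcal{G})=D$. *)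

(* Defs.v *)
From mathcomp Require Import all_boot all_order all_algebra.
From mathcomp Require Import boolp.

Set Implicit Arguments.
Unset Strict Implicit.
Unset Printing Implicit Defensive.

Local Open Scope nat_scope.

(** * Temporal graphs *)

(* The vertex set is 'I_n and edges are 2-element sets of vertices; [tg_label]
   is only meaningful on [tg_edges]. *)
Record temporal_graph (n : nat) := TemporalGraph {
  tg_edges : {set {set 'I_n}};
  tg_label : {set 'I_n} -> pred nat;
  tg_simple : forall e, e \in tg_edges -> #|e| = 2;
  tg_label_pos : forall e t, e \in tg_edges -> tg_label e t -> 0 < t
}.

(* As time labels are positive, residues modulo the period are taken in
   {1, ..., Delta} rather than in {0, ..., Delta - 1}. *)
Definition pmod (t Delta : nat) : nat := (t.-1 %% Delta).+1.

Definition periodic (n : nat) (Delta : nat) (G : temporal_graph n) : Prop :=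
  forall e t, e \in tg_edges G -> 0 < t ->
    tg_label G e t = tg_label G e (pmod t Delta).

Definition temporal_edge (n : nat) (G : temporal_graph n) (u v : 'I_n)
    (t : nat) : bool :=
  ([set u; v] \in tg_edges G) && tg_label G [set u; v] t.

(* The path u = v_0, ..., v_k with times t_1 < ... < t_k is given by u and the
   sequence (v_1, t_1), ..., (v_k, t_k). The start is given the time 0, which
   is below every label. *)
Definition strict_temporal_path (n : nat) (G : temporal_graph n) (u v : 'I_n)
    (p : seq ('I_n * nat)) : bool :=
  [&& path (fun a b => temporal_edge G a.1 b.1 b.2 && (a.2 < b.2)) (u, 0) p,
      uniq (u :: unzip1 p)
    & last u (unzip1 p) == v].

Definition arrival_time (n : nat) (p : seq ('I_n * nat)) : nat :=
  last 0 (unzip2 p).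

Definition reaches_at (n : nat) (G : temporal_graph n) (u v : 'I_n) (t : nat) :
    Prop :=
  exists p, strict_temporal_path G u v p /\ arrival_time p = t.

(* [None] stands for infinity. *)
Definition foremost (n : nat) (G : temporal_graph n) (u v : 'I_n) :
    option nat :=
  match pselect (exists t, `[< reaches_at G u v t >]) with
  | left ex_t => Some (ex_minn ex_t)
  | right _ => None
  end.

Definition Fo (n : nat) (G : temporal_graph n) : 'M[option nat]_n :=
  \matrix_(u, v) (if u == v then Some 0 else foremost G u v).

Definition distance_matrix (n : nat) (D : 'M[option nat]_n) : Prop :=
  forall u v, D u v = Some 0 <-> u = v.

Definition realization (n : nat) (D : 'M[option nat]_n) (Delta : nat)
    (G : temporal_graph n) : Prop :=
  periodic Delta G /\ Fo G = D.

Definition realizable (n : nat) (D : 'M[option nat]_n) (Delta : nat) : Prop :=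
  exists G : temporal_graph n, realization D Delta G.

(* The number of pairs (e, t) with t a label of e and t0 < t <= t0 + len. *)
Definition labels_in_window (n : nat) (G : temporal_graph n) (t0 len : nat) :
    nat :=
  \sum_(e in tg_edges G) count (tg_label G e) (iota t0.+1 len).

(** * Word RAM *)

Inductive binop := Add | Sub | Mul | Div | Mod.

Definition eval_binop (o : binop) : nat -> nat -> nat :=
  match o with
  | Add => addn | Sub => subn | Mul => muln | Div => divn | Mod => modn
  end.

(* Operands are register numbers, except the constant of [Const] and the jump
   targets, which are positions in the program. *)
Inductive instr :=
  | Const (r c : nat)               (* r := c *)
  | Op (o : binop) (r a b : nat)    (* r := a o b *)
  | LoadMem (r a : nat)             (* r := mem[a] *)
  | StoreMem (a r : nat)            (* mem[a] := r *)
  | Jump (l : nat)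
  | JumpLt (a b l : nat)            (* if a < b then goto l *)
  | Halt.

Definition program := seq instr.

Record config := Config {
  pc : nat;
  regs : nat -> nat;
  memory : nat -> nat
}.

Definition set_reg (W : nat) (c : config) (r x : nat) : option config :=
  if x < W then Some (Config (pc c).+1 [eta regs c with r |-> x] (memory c))
  else None.

(* One step of a machine with [M] memory cells, whose words hold the values
   below [W]. Overflow, access to an address >= M, and leaving the program are
   faults: the result is [None], so that a run which reaches [Halt] has stayed
   within both limits. There is no step from [Halt] either. The registers are
   not counted in [M]; a program mentions only finitely many of them. *)
Definition step (M W : nat) (P : program) (c : config) : option config :=
  match onth P (pc c) with
  | Some (Const r x) => set_reg W c r x
  | Some (Op o r a b) => set_reg W c r (eval_binop o (regs c a) (regs c b))
  | Some (LoadMem r a) =>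
      if regs c a < M then set_reg W c r (memory c (regs c a)) else None
  | Some (StoreMem a r) =>
      if regs c a < M
      then Some (Config (pc c).+1 (regs c)
                        [eta memory c with regs c a |-> regs c r])
      else None
  | Some (Jump l) => Some (Config l (regs c) (memory c))
  | Some (JumpLt a b l) =>
      Some (Config (if regs c a < regs c b then l else (pc c).+1)
                   (regs c) (memory c))
  | Some Halt | None => None
  end.

Definition run (M W : nat) (P : program) (k : nat) (c : config) :
    option config :=
  iter k (obind (step M W P)) (Some c).

Definition halted (P : program) (c : config) : Prop :=
  onth P (pc c) = Some Halt.

(** * The computational problem *)

Definition encode_entry (x : option nat) : nat :=
  if x is Some d then d.+1 else 0.

(* Memory initially holds n, Delta and the rows of D; all else is 0. *)
Definition initial (n : nat) (D : 'M[option nat]_n) (Delta : nat) : config :=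
  Config 0 (fun _ => 0)
    (nth 0 [:: n, Delta &
      [seq encode_entry (D u v) | u <- enum 'I_n, v <- enum 'I_n]]).

Definition magnitude (n : nat) (D : 'M[option nat]_n) (Delta : nat) : nat :=
  n + Delta + \max_(u < n) \max_(v < n) odflt 0 (D u v) + 2.

(* On this instance, [P] halts after at most [T] steps, using the memory cells
   below [M] only (those of the input and output included) and words of
   [k * log2 (magnitude D Delta)] bits, with final memory satisfying [post]. *)
Definition computes (P : program) (k T M : nat) (n : nat)
    (D : 'M[option nat]_n) (Delta : nat) (post : (nat -> nat) -> Prop) : Prop :=
  exists (t : nat) (c : config),
    [/\ t <= T,
        run M (magnitude D Delta ^ k) P t (initial D Delta) = Some c,
        halted P c
      & post (memory c)].

(* The final memory lists temporal edges (u, v, t): their number is in cell 1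
   and the entries follow from cell 2 on. *)
Definition output_list (m : nat -> nat) : seq (nat * nat * nat) :=
  mkseq (fun i => (m (3 * i + 2), m (3 * i + 3), m (3 * i + 4))) (m 1).

(* [L] lists exactly the temporal edges of [G] up to time [Delta], each in one
   of its two orientations or in both, possibly with repetitions. *)
Definition represents (n : nat) (Delta : nat) (L : seq (nat * nat * nat))
    (G : temporal_graph n) : Prop :=
  (forall u v t, (u, v, t) \in L ->
     [/\ u < n, v < n, u != v & 0 < t <= Delta]) /\
  (forall (u v : 'I_n) t, 0 < t <= Delta ->
     temporal_edge G u v t =
       ((val u, val v, t) \in L) || ((val v, val u, t) \in L)).

Definition bigO (f g : nat -> nat) : Prop :=
  exists c n0, forall n, n0 <= n -> f n <= c * g n.

(* Main.v *)
Require Import Defs.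
From mathcomp Require Import all_boot all_order all_algebra.
From mathcomp Require Import boolp zify.

Set Implicit Arguments.
Unset Strict Implicit.
Unset Printing Implicit Defensive.

Local Open Scope nat_scope.

(* An edge vw may carry a label t exactly if, for every source x, D(x,v) and
   D(x,w) are both finite or both infinite and no time congruent to t lies
   strictly between them. Hence D is realizable iff every finite D(u,v) with
   u <> v admits some w with D(u,w) < D(u,v) such that vw may carry D(u,v); one
   such label for each pair (u,v) already gives a realization.

   Fix v and w. The number of forbidding pairs (x, time) for the residue z is,
   with a < b the two distances of x to v and w, the sum over x of
   b/Delta - a/Delta + [a mod Delta < z] - [b mod Delta <= z]. It has to be
   evaluated at the n residues D(u,v) mod Delta only. These are sorted once for
   each v; the brackets are then step functions of the position of z, whose
   jumps are located by binary search in O(log n), and prefix sums of the jumps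
   give all n values. This is O(n log n) for each pair (v,w). *)

(** The criterion rests on one inequality: if the edge vw is present at time t, then D(x,w) < t
    forces D(x,v) <= t for every source x, and likewise with v and w exchanged. Periodicity imposes
    it at all times congruent to t; at a late enough one it makes D(x,v) and D(x,w) finite together.
    Conversely, following the same inequality along a path shows that permitted labels never produce
    an arrival earlier than D, while the chosen last edges supply paths arriving in time, by
    induction on D(u,v). Each label is thus permitted or not on its own, and the choices for
    different pairs do not interfere.

    The bounds concern a RAM with absolute jumps, one flat memory and bounded words. The algorithm
    is therefore written in a small language with arrays and counted loops, verified by weakest
    preconditions and compiled once and for all. As every loop carries a bound, n or logarithmic,
    the step count is a function of the syntax alone; a bound on stored values together with the
    nesting depth of expressions yields the word size. *)

(** * A structured language with arrays and counted loops *)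

Inductive exp :=
  | V (r : nat)
  | C (c : nat)
  | Bin (o : binop) (e1 e2 : exp)
  | Ld (a : nat) (e : exp).

(** The boolean of [For] selects one of two bounds on the number of rounds, later n and a logarithm
    of n, from which the running time is computed. *)
Inductive cmd :=
  | Asg (r : nat) (e : exp)
  | Sto (a : nat) (e1 e2 : exp)
  | Seq (c1 c2 : cmd)
  | Ifl (e1 e2 : exp) (c1 c2 : cmd)
  | Skip
  | For (i b : nat) (bd : bool) (c : cmd).

Record state := State { var : nat -> nat; arr : nat -> nat -> nat }.

(** Variables are compared by [eqn], which reduces on numerals, so that reading a variable of an
    updated state computes. *)
Definition setv (s : state) (r x : nat) : state :=
  State (fun r' => if eqn r' r then x else var s r') (arr s).

Definition seta (s : state) (a i x : nat) : state :=
  State (var s) (fun a' i' => if eqn a' a && (i' == i) then x else arr s a' i').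

Fixpoint ev (e : exp) (s : state) : nat :=
  match e with
  | V r => var s r
  | C c => c
  | Bin o e1 e2 => eval_binop o (ev e1 s) (ev e2 s)
  | Ld a e => arr s a (ev e s)
  end.

(** * Weakest preconditions *)

Section WP.

Variables (S B : nat) (bound : bool -> nat).

Fixpoint okE (e : exp) (s : state) : Prop :=
  match e with
  | V _ | C _ => True
  | Bin _ e1 e2 => okE e1 s /\ okE e2 s
  | Ld _ e => okE e s /\ ev e s < S
  end.

(** The compiled loop reads the counter and the limit again in every round; the two equations make
    its test agree with the count [m] fixed at the start. *)
Fixpoint wploop (F : (state -> Prop) -> state -> Prop) (i b k m j : nat)
    (Q : state -> Prop) (s : state) : Prop :=
  match m with
  | 0 => Q s
  | m.+1 => F (fun s' => [/\ var s' b = k, var s' i = j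
                          & wploop F i b k m j.+1 Q (setv s' i j.+1)]) s
  end.

(** Only values that are stored must be below [B]. Intermediate results may be larger; their size is
    controlled by the depth of the expression. *)
Fixpoint wp (c : cmd) (Q : state -> Prop) (s : state) : Prop :=
  match c with
  | Asg r e => okE e s /\ (ev e s < B /\ Q (setv s r (ev e s)))
  | Sto a e1 e2 =>
      okE e1 s /\ (okE e2 s /\ (ev e1 s < S /\ (ev e2 s < B /\
        Q (seta s a (ev e1 s) (ev e2 s)))))
  | Seq c1 c2 => wp c1 (wp c2 Q) s
  | Ifl e1 e2 c1 c2 =>
      okE e1 s /\ (okE e2 s /\
        if ev e1 s < ev e2 s then wp c1 Q s else wp c2 Q s)
  | Skip => Q s
  | For i b bd c =>
      var s b <= bound bd /\
      wploop (wp c) i b (var s b) (var s b) 0 Q (setv s i 0)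
  end.

Lemma wp_mono c (Q Q' : state -> Prop) s :
  (forall s', Q s' -> Q' s') -> wp c Q s -> wp c Q' s.
Proof.
elim: c Q Q' s => [r e|a e1 e2|c1 IH1 c2 IH2|e1 e2 c1 IH1 c2 IH2||i b bd c IH] Q Q' s QQ' /=.
- by case=> ? [? /QQ'].
- by case=> ? [? [? [? /QQ']]].
- by apply: IH1 => s'; apply: IH2.
- case=> ? [?]; case: ifP => _ H; do 2 split=> //; [exact: IH1 H|exact: IH2 H].
- exact: QQ'.
- case=> sb H; split=> //.
  move: H; move: {2 4}(var s b) => m; move: (setv s i 0) => s0.
  elim: m 0 s0 => [|m IHm] j s0 /=; first exact: QQ'.
  by apply: IH => s' [? ? /IHm].
Qed.

Fixpoint mods (c : cmd) : seq nat :=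
  match c with
  | Asg r _ => [:: r]
  | Sto _ _ _ | Skip => [::]
  | Seq c1 c2 | Ifl _ _ c1 c2 => mods c1 ++ mods c2
  | For i _ _ c => i :: mods c
  end.

Fixpoint amods (c : cmd) : seq nat :=
  match c with
  | Sto a _ _ => [:: a]
  | Asg _ _ | Skip => [::]
  | Seq c1 c2 | Ifl _ _ c1 c2 => amods c1 ++ amods c2
  | For _ _ _ c => amods c
  end.

Definition frame (ms aas : seq nat) (s s' : state) : Prop :=
  (forall r, r \notin ms -> var s' r = var s r) /\
  (forall a, a \notin aas -> arr s' a = arr s a).

Lemma frame_trans ms aas s1 s2 s3 :
  frame ms aas s1 s2 -> frame ms aas s2 s3 -> frame ms aas s1 s3.
Proof.
move=> [h1 k1] [h2 k2].
by split=> r rn; [rewrite h2 // h1|rewrite k2 // k1].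
Qed.

Lemma frame_sub ms aas ms' aas' s1 s2 :
  {subset ms <= ms'} -> {subset aas <= aas'} ->
  frame ms aas s1 s2 -> frame ms' aas' s1 s2.
Proof.
move=> h k [f g]; split=> r rn.
  by apply: f; apply: contra rn; apply: h.
by apply: g; apply: contra rn; apply: k.
Qed.

Lemma frame_setv ms aas s r x : r \in ms -> frame ms aas s (setv s r x).
Proof.
move=> rm; split=> // r' /=; case: eqnP => // ->; by rewrite rm.
Qed.

Lemma frame_seta ms aas s a i x : a \in aas -> frame ms aas s (seta s a i x).
Proof.
move=> am; split=> // a' /=; case: eqnP => // ->; by rewrite am.
Qed.

(** What a command leaves alone can be read off its syntax, so that specifications need to mention
    only what changes. *)
Lemma wp_frame c Q s :
  wp c Q s -> wp c (fun s' => Q s' /\ frame (mods c) (amods c) s s') s.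
Proof.
elim: c Q s => [r e|a e1 e2|c1 IH1 c2 IH2|e1 e2 c1 IH1 c2 IH2||i b bd c IH] Q s /=.
- case=> ? [? ?]; do 3 split=> //.
  by case: (@frame_setv [:: r] [::] s r (ev e s)); rewrite ?inE.
- case=> ? [? [? [? ?]]]; do 5 split=> //.
  exact/frame_seta/mem_head.
- move=> /IH1; apply: wp_mono => s' [/IH2 H f]; apply: wp_mono H.
  move=> s'' [? f']; split=> //; apply: frame_trans.
    by apply: frame_sub f => x; rewrite mem_cat => ->.
  by apply: frame_sub f' => x; rewrite mem_cat orbC => ->.
- case=> ? [?]; case: ifP => _ H; do 2 split=> //.
    apply: wp_mono (IH1 _ _ H) => s' [? f]; split=> //.
    by apply: frame_sub f => x; rewrite mem_cat => ->.
  apply: wp_mono (IH2 _ _ H) => s' [? f]; split=> //.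
  by apply: frame_sub f => x; rewrite mem_cat orbC => ->.
- by split.
- case=> sb H; split=> //.
  move: H; move: {2 4}(var s b) => m.
  have: frame (i :: mods c) (amods c) s (setv s i 0).
    by apply: frame_setv; rewrite mem_head.
  move: (setv s i 0) => s0.
  elim: m 0 s0 => [|m IHm] j s0 fr /=; first by split.
  move=> /IH; apply: wp_mono => s' [[? ? H] f]; split=> //.
  apply: IHm => //; apply: (frame_trans fr).
  apply: frame_trans (frame_setv _ _ _ (mem_head _ _)).
  by apply: frame_sub f => x // xm; rewrite inE xm orbT.
Qed.

(** The invariant rule: [I j] describes the state on entry to round j, with the counter already set
    to j. The frame relative to the start of the loop is supplied in each round, which keeps
    unchanged data out of the invariants. *)
Lemma wp_for (I : nat -> state -> Prop) i b bd c Q s :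
  [&& i \notin mods c, b \notin mods c & b != i] ->
  var s b <= bound bd ->
  I 0 (setv s i 0) ->
  (forall j s', j < var s b -> frame (i :: mods c) (amods c) s s' ->
     var s' i = j -> I j s' -> wp c (fun s'' => I j.+1 (setv s'' i j.+1)) s') ->
  (forall s', frame (i :: mods c) (amods c) s s' ->
     I (var s b) s' -> Q s') ->
  wp (For i b bd c) Q s.
Proof.
move=> /and3P[ic bc bi] sb I0 IS IQ /=; split=> //.
have: frame (i :: mods c) (amods c) s (setv s i 0).
  by apply: frame_setv; rewrite mem_head.
move: I0; have: var (setv s i 0) i = 0 by rewrite /= (introT eqnP erefl).
have: 0 + var s b = var s b by [].
move: {1 4}(var s b) => m; move: (setv s i 0) => s0.
elim: m 0 s0 => [|m IHm] j s0; rewrite ?addn0.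
  by move=> -> _ I0 fr; apply: IQ.
move=> jm s0i I0 fr /=.
have H : wp c (fun s'' => I j.+1 (setv s'' i j.+1)) s0.
  by apply: IS => //; rewrite -jm addnS ltnS leq_addr.
apply: wp_mono (wp_frame H) => s' [I1 f]; split.
- by rewrite (f.1 _ bc) fr.1 // inE negb_or bi.
- by rewrite (f.1 _ ic).
- apply: IHm => //; first by rewrite -jm addnS.
    by rewrite /= (introT eqnP erefl).
  apply: (frame_trans fr).
  apply: frame_trans (frame_setv _ _ _ (mem_head _ _)).
  by apply: frame_sub f => x // xm; rewrite inE xm orbT.
Qed.

End WP.

(** * Compilation *)

(* Registers below 32 hold the variables, those from 32 on the intermediate
   values of expressions. Register 0 always holds 0, so that an addition copies
   a register; register 1 holds the distance S between consecutive arrays. *)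
Local Notation K := 32.

(** The registers from [K] on form an evaluation stack with [d] entries in use; the result is pushed
    on top. *)
Fixpoint cexp (d : nat) (e : exp) : program :=
  match e with
  | V r => [:: Op Add (K + d) r 0]
  | C c => [:: Const (K + d) c]
  | Bin o e1 e2 => cexp d e1 ++ cexp d.+1 e2 ++ [:: Op o (K + d) (K + d) (K + d.+1)]
  | Ld a e => cexp d e ++
      [:: Const (K + d.+1) a; Op Mul (K + d.+1) (K + d.+1) 1;
          Op Add (K + d) (K + d) (K + d.+1); LoadMem (K + d) (K + d)]
  end.

(** Jump targets are absolute, hence the argument [l], the position at which the code will stand. In
    a conditional the second branch is placed first, since [JumpLt] jumps when the test succeeds. *)
Fixpoint compile (l : nat) (c : cmd) : program :=
  match c with
  | Asg r e => cexp 0 e ++ [:: Op Add r K 0]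
  | Sto a e1 e2 => cexp 0 e1 ++ cexp 1 e2 ++
      [:: Const (K + 2) a; Op Mul (K + 2) (K + 2) 1; Op Add K K (K + 2);
          StoreMem K (K + 1)]
  | Seq c1 c2 => let p1 := compile l c1 in p1 ++ compile (l + size p1) c2
  | Ifl e1 e2 c1 c2 =>
      let p0 := cexp 0 e1 ++ cexp 1 e2 in
      let p2 := compile (l + size p0 + 1) c2 in
      let l1 := l + size p0 + 1 + size p2 + 1 in
      let p1 := compile l1 c1 in
      p0 ++ JumpLt K (K + 1) l1 :: p2 ++ Jump (l1 + size p1) :: p1
  | Skip => [::]
  | For i b _ c =>
      let p := compile (l + 3) c in
      [:: Const i 0, JumpLt i b (l + 3), Jump (l + 3 + size p + 3) & p] ++
      [:: Const K 1; Op Add i i K; Jump (l + 1)]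
  end.

(** A round costs 4 steps besides the body: test, constant, increment, jump back. The final 3 are
    the initialization, the failing test and the exit jump. *)
Fixpoint time (bound : bool -> nat) (c : cmd) : nat :=
  match c with
  | Asg _ e => size (cexp 0 e) + 1
  | Sto _ e1 e2 => size (cexp 0 e1) + size (cexp 1 e2) + 4
  | Seq c1 c2 => time bound c1 + time bound c2
  | Ifl e1 e2 c1 c2 =>
      size (cexp 0 e1) + size (cexp 1 e2) + 2 + (time bound c1 + time bound c2)
  | Skip => 0
  | For _ _ bd c => bound bd * (time bound c + 4) + 3
  end.

Fixpoint wfE (h : nat) (e : exp) : bool :=
  match e, h with
  | V r, _ => r < K
  | C c, _ => c < 100
  | Bin _ e1 e2, h.+1 => wfE h e1 && wfE h e2
  | Ld a e, h.+1 => (a < 6) && wfE h e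
  | _, _ => false
  end.

Fixpoint wfC (h : nat) (c : cmd) : bool :=
  match c with
  | Asg r e => (1 < r < K) && wfE h e
  | Sto a e1 e2 => [&& a < 6, wfE h e1 & wfE h e2]
  | Seq c1 c2 => wfC h c1 && wfC h c2
  | Ifl e1 e2 c1 c2 => [&& wfE h e1, wfE h e2, wfC h c1 & wfC h c2]
  | Skip => true
  | For i b _ c => [&& 1 < i < K, b < K, b != i & wfC h c]
  end.

Lemma arr_inj S a i a' i' : i < S -> i' < S ->
  a * S + i = a' * S + i' -> a = a' /\ i = i'.
Proof.
move=> iS iS' E; have S0 : 0 < S by lia.
have h := congr1 (divn^~ S) E; have k := congr1 (modn^~ S) E.
move: h k; rewrite !divnMDl // !modnMDl !modn_small // !divn_small //; lia.
Qed.

Section Soundness.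

Variables (S B W H : nat) (bound : bool -> nat).
Hypothesis B_ge : 100 <= B.
Hypothesis S_lt : S < B.
Hypothesis W_ge : B ^ (2 ^ H.+2) <= W.

Notation M := (6 * S).

Definition simulates (c : config) (s : state) : Prop :=
  [/\ forall r, r < K -> regs c r = var s r,
      forall a i, a < 6 -> i < S -> memory c (a * S + i) = arr s a i,
      var s 0 = 0 /\ var s 1 = S,
      forall r, r < K -> var s r < B
    & forall a i, a < 6 -> i < S -> arr s a i < B].

Lemma run_add P k1 k2 c1 c2 c3 :
  run M W P k1 c1 = Some c2 -> run M W P k2 c2 = Some c3 ->
  run M W P (k1 + k2) c1 = Some c3.
Proof. by rewrite /run addnC iterD => ->. Qed.

Lemma onth_at (p1 : program) x p2 : onth (p1 ++ x :: p2) (size p1) = Some x.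
Proof. by elim: p1. Qed.

Lemma B_gt0 : 0 < B. Proof. by lia. Qed.

Lemma BB_le h : h <= H.+2 -> B ^ (2 ^ h) <= W.
Proof.
move=> hH; apply: leq_trans W_ge.
by rewrite leq_pexp2l ?B_gt0 // leq_pexp2l.
Qed.

Lemma B_le_exp h : B <= B ^ (2 ^ h).
Proof. by rewrite -{1}(expn1 B) leq_pexp2l ?B_gt0 // expn_gt0. Qed.

Lemma eval_binop_lt o x y X :
  1 < X -> x < X -> y < X -> eval_binop o x y < X * X.
Proof.
move=> X1 xX yX.
have hX : X <= X * X by rewrite leq_pmull //; lia.
case: o => /=.
- have h2X : X + X <= X * X by nia.
  by lia.
- by lia.
- by rewrite ltn_mul.
- by apply: leq_ltn_trans (leq_div _ _) _; lia.
- by apply: leq_ltn_trans (leq_mod _ _) _; lia.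
Qed.

(** Variables, constants and array cells are below [B], and each operation at most squares the
    bound; this gives the double exponent in the height. *)
Lemma wfE_lt h e s : wfE h e -> okE S e s ->
  (forall r, r < K -> var s r < B) ->
  (forall a i, a < 6 -> i < S -> arr s a i < B) ->
  ev e s < B ^ (2 ^ h).
Proof.
elim: e h => [r|c|o e1 IH1 e2 IH2|a e IH] h.
- move=> rK _ vB _; apply: leq_trans (B_le_exp h); apply: vB; by case: h rK.
- move=> cK _ vB _; apply: leq_trans (B_le_exp h); case: h cK => [|h] /=; lia.
- case: h => // h /= /andP[w1 w2] [o1 o2] vB aB.
  rewrite expnS mulSn mul1n expnD; apply: eval_binop_lt.
  + by apply: leq_trans (B_le_exp h); lia.
  + exact: IH1.
  + exact: IH2.
- case: h => // h /= /andP[a6 w] [o1 o2] vB aB.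
  by apply: leq_trans (B_le_exp _); apply: aB.
Qed.

Lemma addr_lt a i : a < 6 -> i < S -> a * S + i < M.
Proof.
move=> a6 iS; have : a * S <= 5 * S by rewrite leq_mul2r; lia.
by lia.
Qed.

Lemma BB_ltW x : x < B * B -> x < W.
Proof.
move=> xB; apply: leq_trans xB (leq_trans _ (@BB_le 1 isT)).
by rewrite expn1 mulnn.
Qed.

Lemma ltB_ltW x : x < B -> x < W.
Proof. by move=> xB; apply: BB_ltW; nia. Qed.

Definition goto (c : config) (l : nat) := Config l (regs c) (memory c).

Lemma exec_const P c r x : onth P (pc c) = Some (Const r x) -> x < W ->
  run M W P 1 c = Some (Config (pc c).+1 [eta regs c with r |-> x] (memory c)).
Proof. by move=> E xW; rewrite /run /= /step E /set_reg xW. Qed.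

Lemma exec_op P c o r a b x : onth P (pc c) = Some (Op o r a b) ->
  eval_binop o (regs c a) (regs c b) = x -> x < W ->
  run M W P 1 c = Some (Config (pc c).+1 [eta regs c with r |-> x] (memory c)).
Proof. by move=> E <- xW; rewrite /run /= /step E /set_reg xW. Qed.

Lemma exec_load P c r a x : onth P (pc c) = Some (LoadMem r a) ->
  regs c a < M -> memory c (regs c a) = x -> x < W ->
  run M W P 1 c = Some (Config (pc c).+1 [eta regs c with r |-> x] (memory c)).
Proof. by move=> E aM <- xW; rewrite /run /= /step E aM /set_reg xW. Qed.

Lemma exec_store P c a r : onth P (pc c) = Some (StoreMem a r) ->
  regs c a < M ->
  run M W P 1 c = Some (Config (pc c).+1 (regs c)
     [eta memory c with regs c a |-> regs c r]).
Proof. by move=> E aM; rewrite /run /= /step E aM. Qed.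

Lemma exec_jump P c l : onth P (pc c) = Some (Jump l) ->
  run M W P 1 c = Some (goto c l).
Proof. by move=> E; rewrite /run /= /step E. Qed.

Lemma exec_jumplt P c a b l : onth P (pc c) = Some (JumpLt a b l) ->
  run M W P 1 c = Some (goto c (if regs c a < regs c b then l else (pc c).+1)).
Proof. by move=> E; rewrite /run /= /step E. Qed.

Lemma onth_code (P p1 q p2 : program) x k :
  P = p1 ++ q ++ p2 -> onth q (k - size p1) = Some x -> size p1 <= k ->
  onth P k = Some x.
Proof.
move=> -> + kp; rewrite -{2}(subnKC kp); move: (k - size p1) => j E.
elim: p1 {kp} => [|y p1 IH] //=.
by elim: q j E => [|y q IH] [|j] //= /IH.
Qed.

(** The registers below [K + d] comprise the variables and the pending operands of enclosing
    expressions, all of which must survive. *)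
Definition evaluates (P : program) (k d x : nat) (c : config) : Prop :=
  exists c', [/\ run M W P k c = Some c', pc c' = pc c + k,
    memory c' = memory c, regs c' (K + d) = x
    & forall r, r < K + d -> regs c' r = regs c r].

Lemma simulates_regs c c' s : (forall r, r < K -> regs c' r = regs c r) ->
  memory c' = memory c -> simulates c s -> simulates c' s.
Proof.
by move=> rE mE [h1 h2 h3 h4 h5]; split=> // [r rK|a i]; rewrite ?mE ?rE //; auto.
Qed.

Lemma cexp_ok e h d s P p1 p2 c :
  P = p1 ++ cexp d e ++ p2 -> pc c = size p1 -> simulates c s -> wfE h e ->
  h <= H.+2 -> okE S e s -> evaluates P (size (cexp d e)) d (ev e s) c.
Proof.
elim: e h d p1 p2 c => [r|x|o e1 IH1 e2 IH2|a e IH] h d p1 p2 c PE pcE R wf hH ok.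
- have rK : r < K by case: h wf {hH}.
  case: (R) => h1 h2 [h3 _] h4 h5.
  eexists; split.
  + apply: (@exec_op _ _ Add (K + d) r 0 (var s r)).
    * by apply: (onth_code PE); rewrite pcE // subnn.
    * by rewrite /= !h1 // h3 addn0.
    * exact/ltB_ltW/h4.
  + by rewrite addn1.
  + by [].
  + by rewrite /= eqxx.
  + by move=> r' lt; rewrite /=; case: eqP => // E; lia.
- eexists; split.
  + apply: (@exec_const _ _ (K + d) x).
    * by apply: (onth_code PE); rewrite pcE // subnn.
    * by apply: ltB_ltW; apply: leq_trans B_ge; case: h wf {hH}.
  + by rewrite addn1.
  + by [].
  + by rewrite /= eqxx.
  + by move=> r' lt; rewrite /=; case: eqP => // E; lia.
- case: h wf hH => // h wf hH; have /= /andP[w1 w2] := wf; have /= [o1 o2] := ok.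
  have PE1 : P = p1 ++ cexp d e1 ++
      (cexp d.+1 e2 ++ [:: Op o (K + d) (K + d) (K + d.+1)] ++ p2).
    by rewrite PE /= -!catA.
  have [c1 [run1 pc1 mem1 r1 f1]] := IH1 h d _ _ c PE1 pcE R w1 (ltnW hH) o1.
  have R1 : simulates c1 s by apply: simulates_regs R => // r rK; apply: f1; lia.
  have PE2 : P = (p1 ++ cexp d e1) ++ cexp d.+1 e2 ++
      ([:: Op o (K + d) (K + d) (K + d.+1)] ++ p2).
    by rewrite PE /= -!catA.
  have pc1' : pc c1 = size (p1 ++ cexp d e1) by rewrite pc1 pcE size_cat.
  have [c2 [run2 pc2 mem2 r2 f2]] := IH2 h d.+1 _ _ c1 PE2 pc1' R1 w2 (ltnW hH) o2.
  have PE3 : P = (p1 ++ cexp d e1 ++ cexp d.+1 e2) ++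
      [:: Op o (K + d) (K + d) (K + d.+1)] ++ p2.
    by rewrite PE /= -!catA.
  eexists; split.
  + rewrite /= !size_cat addnA /=; apply: run_add (run_add run1 run2) _.
    apply: (@exec_op _ _ o (K + d) (K + d) (K + d.+1) (ev (Bin o e1 e2) s)).
    * by apply: (onth_code PE3); rewrite pc2 pc1' !size_cat ?addnA ?subnn.
    * by rewrite /= r2 f2 ?r1 //; lia.
    * case: R => _ _ _ h4 h5.
      exact: leq_trans (wfE_lt wf ok h4 h5) (BB_le hH).
  + by rewrite /= pc2 pc1 !size_cat /=; lia.
  + by rewrite /= mem2 mem1.
  + by rewrite /= eqxx.
  + move=> r lt; rewrite /=; case: eqP => [E|_]; first lia.
    by rewrite f2 ?f1 //; lia.
- case: h wf hH => // h wf hH; have /= /andP[a6 w] := wf; have /= [o1 eS] := ok.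
  have PE1 : P = p1 ++ cexp d e ++ ([:: Const (K + d.+1) a;
     Op Mul (K + d.+1) (K + d.+1) 1; Op Add (K + d) (K + d) (K + d.+1);
     LoadMem (K + d) (K + d)] ++ p2).
    by rewrite PE /= -!catA.
  have [c1 [run1 pc1 mem1 r1 f1]] := IH h d _ _ c PE1 pcE R w (ltnW hH) o1.
  case: (R) => h1 h2 [h31 h32] h4 h5.
  have PE3 : P = (p1 ++ cexp d e) ++ [:: Const (K + d.+1) a;
     Op Mul (K + d.+1) (K + d.+1) 1; Op Add (K + d) (K + d) (K + d.+1);
     LoadMem (K + d) (K + d)] ++ p2.
    by rewrite PE /= -!catA.
  have pc1' : pc c1 = size (p1 ++ cexp d e) by rewrite pc1 pcE size_cat.
  have n1 : (K + d.+1 == K + d) = false by apply/eqP; lia.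
  have n2 : (K + d == K + d.+1) = false by apply/eqP; lia.
  have aS := addr_lt a6 eS.
  have SB : M <= B * B by nia.
  eexists; split.
  + rewrite /= !size_cat /=; apply: run_add run1 _; rewrite -[4]/(1 + (1 + (1 + 1))).
    apply: run_add.
      apply: (@exec_const _ _ (K + d.+1) a).
        by apply: (onth_code PE3); rewrite pc1' // subnn.
      by apply: ltB_ltW; lia.
    apply: run_add.
      apply: (@exec_op _ _ Mul (K + d.+1) (K + d.+1) 1 (a * S)).
      * by apply: (onth_code PE3); rewrite /= pc1' // subSnn.
      * by rewrite /= eqxx f1 // h1 // h32.
      * by apply: BB_ltW; lia.
    apply: run_add.
      apply: (@exec_op _ _ Add (K + d) (K + d) (K + d.+1) (a * S + ev e s)).
      * apply: (onth_code PE3); rewrite /= pc1' ?leqW //.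
        by rewrite -(addn2 (size _)) addKn.
      * by rewrite /= eqxx n2 r1 addnC.
      * by apply: BB_ltW; lia.
    apply: (@exec_load _ _ (K + d) (K + d) (arr s a (ev e s))).
    * apply: (onth_code PE3); rewrite /= pc1' ?leqW //.
      by rewrite -(addn3 (size _)) addKn.
    * by rewrite /= eqxx.
    * by rewrite /= eqxx mem1 h2.
    * exact/ltB_ltW/h5.
  + by rewrite /= pc1 size_cat /=; lia.
  + by rewrite /= mem1.
  + by rewrite /= eqxx.
  + move=> r lt; rewrite /=; case: eqP => [E|_]; first lia.
    by case: eqP => [E|_]; [lia|rewrite f1].
Qed.

Lemma simulates_setv c c' s r x : simulates c s -> 1 < r < K -> x < B ->
  (forall r', r' < K -> regs c' r' = if r' == r then x else regs c r') ->
  memory c' = memory c -> simulates c' (setv s r x).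
Proof.
move=> [h1 h2 [h3 h3'] h4 h5] /andP[r1 rK] xB rE mE; split=> //=.
- by move=> r' r'K; rewrite rE // eqnE; case: eqP => // _; apply: h1.
- by move=> a i; rewrite mE; apply: h2.
- by case: r r1 {rK rE} => [|[|r]].
- by move=> r' r'K; rewrite eqnE; case: eqP => // _; apply: h4.
Qed.

(** Induction on the command. The code is allowed any surroundings [p1] and [p2], so that the
    hypothesis applies to subcommands in place. *)
Lemma compile_ok c s Q P p1 p2 cfg :
  P = p1 ++ compile (size p1) c ++ p2 -> pc cfg = size p1 -> simulates cfg s ->
  wfC H c -> wp S B bound c Q s ->
  exists k cfg' s', [/\ k <= time bound c, run M W P k cfg = Some cfg',
    pc cfg' = size p1 + size (compile (size p1) c), simulates cfg' s' & Q s'].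
Proof.
have HH : H <= H.+2 by rewrite !leqW.
elim: c s Q p1 p2 cfg => [r e|a e1 e2|c1 IH1 c2 IH2|e1 e2 c1 IH1 c2 IH2||i b bd c IH]
    s Q p1 p2 cfg PE pcE R.
- move=> /= /andP[r1K we] [oe [eB Qs]].
  have PE1 : P = p1 ++ cexp 0 e ++ ([:: Op Add r K 0] ++ p2).
    by rewrite PE /= -!catA.
  have [c1 [run1 pc1 mem1 v1 f1]] := cexp_ok PE1 pcE R we HH oe.
  have PE2 : P = (p1 ++ cexp 0 e) ++ [:: Op Add r K 0] ++ p2.
    by rewrite PE /= -!catA.
  exists (size (cexp 0 e) + 1); eexists; exists (setv s r (ev e s)); split=> //.
  + apply: run_add run1 _.
    apply: (@exec_op _ _ Add r K 0 (ev e s)).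
    * by apply: (onth_code PE2); rewrite pc1 pcE size_cat // subnn.
    * rewrite /= (f1 0) //; case: R => -> // _ [-> _] _ _.
      by rewrite addn0 -[32]/(K + 0) v1.
    * exact: ltB_ltW.
  + by rewrite /= size_cat pc1 pcE /=; lia.
  + apply: (simulates_setv R r1K eB); last by rewrite /= mem1.
    by move=> r' r'K /=; case: eqP => // _; rewrite f1 //; lia.
- move=> /= /and3P[a6 w1 w2] [o1 [o2 [eS [eB Qs]]]].
  set tl := [:: Const (K + 2) a; Op Mul (K + 2) (K + 2) 1; Op Add K K (K + 2);
    StoreMem K (K + 1)].
  have PE1 : P = p1 ++ cexp 0 e1 ++ (cexp 1 e2 ++ tl ++ p2).
    by rewrite PE /= -!catA.
  have [c1 [run1 pc1 mem1 v1 f1]] := cexp_ok PE1 pcE R w1 HH o1.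
  have PE2 : P = (p1 ++ cexp 0 e1) ++ cexp 1 e2 ++ (tl ++ p2).
    by rewrite PE /= -!catA.
  have pc1' : pc c1 = size (p1 ++ cexp 0 e1) by rewrite pc1 pcE size_cat.
  have R1 : simulates c1 s by apply: simulates_regs R => // r rK; apply: f1; lia.
  have [c2 [run2 pc2 mem2 v2 f2]] := cexp_ok PE2 pc1' R1 w2 HH o2.
  have R2 : simulates c2 s by apply: simulates_regs R1 => // r rK; apply: f2; lia.
  have PE3 : P = (p1 ++ cexp 0 e1 ++ cexp 1 e2) ++ tl ++ p2.
    by rewrite PE /= -!catA.
  have pc2' : pc c2 = size (p1 ++ cexp 0 e1 ++ cexp 1 e2).
    by rewrite pc2 pc1' !size_cat addnA.
  case: (R2) => h1 h2 [h31 h32] h4 h5.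
  have aS := addr_lt a6 eS.
  have SB : M <= B * B by nia.
  exists (size (cexp 0 e1) + size (cexp 1 e2) + 4); eexists.
  exists (seta s a (ev e1 s) (ev e2 s)); split=> //.
  + apply: run_add (run_add run1 run2) _; rewrite -[4]/(1 + (1 + (1 + 1))).
    apply: run_add.
      apply: (@exec_const _ _ (K + 2) a).
        by apply: (onth_code PE3); rewrite pc2' // subnn.
      by apply: ltB_ltW; lia.
    apply: run_add.
      apply: (@exec_op _ _ Mul (K + 2) (K + 2) 1 (a * S)).
      * by apply: (onth_code PE3); rewrite /= pc2' // subSnn.
      * by rewrite /= h1 // h32.
      * by apply: BB_ltW; lia.
    apply: run_add.
      apply: (@exec_op _ _ Add K K (K + 2) (a * S + ev e1 s)).
      * apply: (onth_code PE3); rewrite /= pc2' ?leqW //.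
        by rewrite -(addn2 (size _)) addKn.
      * by rewrite /= f2 // -[32]/(K + 0) v1 addnC.
      * by apply: BB_ltW; lia.
    apply: (@exec_store _ _ K (K + 1)) => //.
    apply: (onth_code PE3); rewrite /= pc2' ?leqW //.
    by rewrite -(addn3 (size _)) addKn.
  + by rewrite /= pc2' !size_cat /=; lia.
  + split=> //=.
    * move=> r rK; rewrite !ifF ?h1 //; apply/eqP; lia.
    * move=> a' i' a'6 i'S; rewrite v2 mem2 mem1 eqnE.
      have -> : (a' * S + i' == a * S + ev e1 s) = (a' == a) && (i' == ev e1 s).
        apply/eqP/andP => [E|[/eqP-> /eqP->] //].
        by have [-> ->] := arr_inj i'S eS E.
      by case: ifP => // _; case: R => _ -> .
    * by move=> a' i' a'6 i'S; case: ifP => // _; apply: h5.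
- move=> /= /andP[w1 w2] W1.
  have PE1 : P = p1 ++ compile (size p1) c1 ++
      (compile (size p1 + size (compile (size p1) c1)) c2 ++ p2).
    by rewrite PE /= -!catA.
  have [k1 [g1 [s1 [t1 run1 pc1 R1 Q1]]]] := IH1 _ _ _ _ _ PE1 pcE R w1 W1.
  have pc1' : pc g1 = size (p1 ++ compile (size p1) c1) by rewrite pc1 size_cat.
  have PE2 : P = (p1 ++ compile (size p1) c1) ++
      compile (size (p1 ++ compile (size p1) c1)) c2 ++ p2.
    by rewrite PE /= size_cat -!catA.
  have [k2 [g2 [s2 [t2 run2 pc2 R2 Q2]]]] := IH2 _ _ _ _ _ PE2 pc1' R1 w2 Q1.
  exists (k1 + k2), g2, s2; split=> //; first exact: leq_add.
    exact: run_add run2.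
  by rewrite pc2 !size_cat addnA.
- move=> /= /and4P[w1 w2 w3 w4] [o1 [o2 Wif]].
  move: PE => /=; set p0 := cexp 0 e1 ++ cexp 1 e2.
  set q2 := compile _ c2; set l1 := size p1 + size p0 + 1 + size q2 + 1.
  set q1 := compile _ c1 => PE.
  have PE1 : P = p1 ++ cexp 0 e1 ++ (cexp 1 e2 ++
      (JumpLt K (K + 1) l1 :: q2 ++ Jump (l1 + size q1) :: q1) ++ p2).
    by rewrite PE /p0 -!catA.
  have [g1 [run1 pc1 mem1 v1 f1]] := cexp_ok PE1 pcE R w1 HH o1.
  have PE2 : P = (p1 ++ cexp 0 e1) ++ cexp 1 e2 ++
      ((JumpLt K (K + 1) l1 :: q2 ++ Jump (l1 + size q1) :: q1) ++ p2).
    by rewrite PE /p0 -!catA.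
  have pc1' : pc g1 = size (p1 ++ cexp 0 e1) by rewrite pc1 pcE size_cat.
  have R1 : simulates g1 s by apply: simulates_regs R => // r rK; apply: f1; lia.
  have [g2 [run2 pc2 mem2 v2 f2]] := cexp_ok PE2 pc1' R1 w2 HH o2.
  have R2 : simulates g2 s by apply: simulates_regs R1 => // r rK; apply: f2; lia.
  have pc2' : pc g2 = size p1 + size p0 by rewrite pc2 pc1' !size_cat addnA.
  have PE3 : P = (p1 ++ p0) ++ [:: JumpLt K (K + 1) l1] ++
      (q2 ++ Jump (l1 + size q1) :: q1 ++ p2).
    by rewrite PE -!catA /= -!catA.
  have run3 : run M W P 1 g2 =
      Some (goto g2 (if ev e1 s < ev e2 s then l1 else (pc g2).+1)).
    have -> : ev e1 s < ev e2 s = (regs g2 K < regs g2 (K + 1)).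
      by rewrite v2 f2 // -[in RHS](addn0 K) v1.
    apply: exec_jumplt; apply: (onth_code PE3); rewrite size_cat pc2' //.
    by rewrite subnn.
  have run123 := run_add (run_add run1 run2) run3.
  have sz0 : size p0 = size (cexp 0 e1) + size (cexp 1 e2) by rewrite size_cat.
  case: ifP run123 Wif => _ run123 Wc.
  + pose pre := p1 ++ p0 ++ JumpLt K (K + 1) l1 :: q2 ++ [:: Jump (l1 + size q1)].
    have sz : size pre = l1 by rewrite !size_cat /= size_cat /= /l1; lia.
    have PE4 : P = pre ++ compile (size pre) c1 ++ p2.
      by rewrite sz PE /pre -!catA /= -!catA.
    have R3 : simulates (goto g2 l1) s by case: R2 => *; split.
    have [k4 [g4 [s4 [t4 run4 pc4 R4 Q4]]]] :=
      IH1 s Q _ p2 (goto g2 l1) PE4 (esym sz) R3 w3 Wc.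
    exists (size (cexp 0 e1) + size (cexp 1 e2) + 1 + k4), g4, s4; split=> //.
    * by lia.
    * exact: run_add run123 run4.
    * by rewrite pc4 sz -/q1 !size_cat /= size_cat /= /l1; lia.
  + pose pre := p1 ++ p0 ++ [:: JumpLt K (K + 1) l1].
    have sz : size pre = size p1 + size p0 + 1 by rewrite !size_cat /=; lia.
    have PE4 : P = pre ++ compile (size pre) c2 ++ (Jump (l1 + size q1) :: q1 ++ p2).
      by rewrite sz PE /pre -!catA /= -!catA.
    have R3 : simulates (goto g2 (pc g2).+1) s by case: R2 => *; split.
    have pc3 : (pc g2).+1 = size pre by rewrite sz pc2' addn1.
    have [k4 [g4 [s4 [t4 run4 pc4 R4 Q4]]]] :=
      IH2 s Q _ _ (goto g2 (pc g2).+1) PE4 pc3 R3 w4 Wc.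
    rewrite sz -/q2 in pc4.
    have PE5 : P = (p1 ++ p0 ++ JumpLt K (K + 1) l1 :: q2) ++
        [:: Jump (l1 + size q1)] ++ (q1 ++ p2).
      by rewrite PE -!catA /= -!catA.
    have run5 : run M W P 1 g4 = Some (goto g4 (l1 + size q1)).
      have szE : pc g4 = size (p1 ++ p0 ++ JumpLt K (K + 1) l1 :: q2).
        by rewrite pc4 !size_cat /=; lia.
      by apply: exec_jump; apply: (onth_code PE5); rewrite szE // subnn.
    exists (size (cexp 0 e1) + size (cexp 1 e2) + 1 + k4 + 1).
    exists (goto g4 (l1 + size q1)), s4; split=> //.
    * by lia.
    * exact: run_add (run_add run123 run4) run5.
    * by rewrite /= !size_cat /= size_cat /= /l1; lia.
- by move=> _ Qs; exists 0, cfg, s; split=> //; rewrite pcE addn0.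
- move=> /= /and4P[iK bK bi wc] [sb Wl]; have [_ iK'] := andP iK.
  move: PE => /=; set q := compile _ c => PE.
  have PE1 : P = p1 ++ [:: Const i 0; JumpLt i b (size p1 + 3);
      Jump (size p1 + 3 + size q + 3)] ++
      (q ++ [:: Const K 1; Op Add i i K; Jump (size p1 + 1)] ++ p2).
    by rewrite PE /= -!catA.
  pose pre := p1 ++ [:: Const i 0; JumpLt i b (size p1 + 3);
    Jump (size p1 + 3 + size q + 3)].
  have sz2 : size pre = size p1 + 3 by rewrite size_cat.
  have PE2 : P = pre ++ compile (size pre) c ++
      ([:: Const K 1; Op Add i i K; Jump (size p1 + 1)] ++ p2).
    by rewrite sz2 PE /pre /= -!catA.
  have PE3 : P = (p1 ++ [:: Const i 0, JumpLt i b (size p1 + 3),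
      Jump (size p1 + 3 + size q + 3) & q]) ++
      [:: Const K 1; Op Add i i K; Jump (size p1 + 1)] ++ p2.
    by rewrite PE /= -!catA.
  have sz3 : size (p1 ++ [:: Const i 0, JumpLt i b (size p1 + 3),
      Jump (size p1 + 3 + size q + 3) & q]) = size p1 + 3 + size q.
    by rewrite size_cat /=; lia.
  (* Induction on the number [m] of remaining rounds, from the loop test at [size p1 + 1]; the 2
     accounts for the failing test and the exit jump. *)
  have loop m : forall j s0 g, j + m = var s b -> var s0 b = var s b ->
      var s0 i = j -> pc g = size p1 + 1 -> simulates g s0 ->
      wploop (wp S B bound c) i b (var s b) m j Q s0 ->
      exists k g' s', [/\ k <= m * (time bound c + 4) + 2,
        run M W P k g = Some g', pc g' = size p1 + 3 + size q + 3, simulates g' s'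
        & Q s'].
    elim: m => [|m IHm] j s0 g jm s0b s0i pcg Rg /=.
    + move=> Qs; case: (Rg) => h1 _ _ _ _.
      have run1 : run M W P 1 g = Some (goto g (size p1 + 2)).
        have -> : size p1 + 2 =
            if regs g i < regs g b then size p1 + 3 else (pc g).+1.
          by rewrite !h1 // s0b s0i -jm addn0 ltnn pcg addn1 addn2.
        apply: exec_jumplt; apply: (onth_code PE1); rewrite pcg ?leq_addr //.
        by rewrite addKn.
      have run2 : run M W P 1 (goto g (size p1 + 2)) =
          Some (goto g (size p1 + 3 + size q + 3)).
        apply: exec_jump; apply: (onth_code PE1); rewrite /= ?leq_addr //.
        by rewrite addKn.
      exists 2, (goto g (size p1 + 3 + size q + 3)), s0; split=> //.
      exact: run_add run1 run2.
    + move=> Wc; case: (Rg) => h1 _ _ h4 _.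
      have run1 : run M W P 1 g = Some (goto g (size p1 + 3)).
        have -> : size p1 + 3 =
            if regs g i < regs g b then size p1 + 3 else (pc g).+1.
          by rewrite !h1 // s0b s0i -jm ifT //; lia.
        apply: exec_jumplt; apply: (onth_code PE1); rewrite pcg ?leq_addr //.
        by rewrite addKn.
      have R1 : simulates (goto g (size p1 + 3)) s0 by case: Rg => *; split.
      have [k2 [g2 [s2 [t2 run2 pc2 R2 [s2b s2i Q2]]]]] :=
        IH s0 _ _ _ (goto g (size p1 + 3)) PE2 (esym sz2) R1 wc Wc.
      rewrite sz2 -/q in pc2.
      have jB : j.+1 < B.
        have : var s2 b < B by case: R2 => _ _ _ + _; apply.
        by lia.
      have run3 : exists g3, [/\ run M W P 3 g2 = Some g3,
          pc g3 = size p1 + 1 & simulates g3 (setv s2 i j.+1)].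
        eexists; split.
        * rewrite -[3]/(1 + (1 + 1)).
          apply: run_add.
            apply: (@exec_const _ _ K 1); last by apply: ltB_ltW; lia.
            by apply: (onth_code PE3); rewrite sz3 pc2 // subnn.
          apply: run_add.
            apply: (@exec_op _ _ Add i i K j.+1); last exact: ltB_ltW.
              apply: (onth_code PE3); rewrite sz3 /= pc2 //.
              by rewrite subSnn.
            rewrite /= ifF; last by apply/eqP; lia.
            by case: R2 => -> // _ _ _ _; rewrite s2i addn1.
          apply: (@exec_jump _ _ (size p1 + 1)).
          apply: (onth_code PE3); rewrite sz3 /= pc2 ?leqW //.
          by rewrite -(addn2 (_ + size q)) addKn.
        * by [].
        * apply: (simulates_setv R2 iK jB) => // r' r'K /=; case: eqP => // _.
          by rewrite ifF //; apply/eqP; lia.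
      have [g3 [run3' pc3 R3]] := run3.
      have [|||k4 [g4 [s4 [t4 run4 pc4 R4 Q4]]]] :=
        IHm j.+1 (setv s2 i j.+1) g3 _ _ _ pc3 R3 Q2.
      * by rewrite -jm addnS.
      * by rewrite /= eqnE (negbTE bi).
      * by rewrite /= eqnE eqxx.
      exists (1 + k2 + (3 + k4)), g4, s4; split=> //.
      * by rewrite mulSn; lia.
      * exact: run_add (run_add run1 run2) (run_add run3' run4).
  have run0 : run M W P 1 cfg = Some
      (Config (pc cfg).+1 [eta regs cfg with i |-> 0] (memory cfg)).
    apply: exec_const; last by apply: ltB_ltW; lia.
    by apply: (onth_code PE1); rewrite pcE // subnn.
  have R0 : simulates (Config (pc cfg).+1 [eta regs cfg with i |-> 0] (memory cfg))
      (setv s i 0).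
    by apply: (simulates_setv R iK) => //; lia.
  have [|||k [g [s' [t run1 pc1 R1 Q1]]]] := loop _ 0 _ _ erefl _ _ _ R0 Wl.
  + by rewrite /= eqnE (negbTE bi).
  + by rewrite /= eqnE eqxx.
  + by rewrite /= pcE addn1.
  exists (1 + k), g, s'; split=> //.
  + apply: leq_trans (_ : 1 + (var s b * (time bound c + 4) + 2) <= _).
      by rewrite leq_add2l.
    by have := leq_mul sb (leqnn (time bound c + 4)); lia.
  + exact: run_add run0 run1.
  + by rewrite pc1 size_cat /=; lia.
Qed.

End Soundness.

(** * Conflicts *)

(* For a < b, the number of integers t with a < t < b and t = z modulo Delta,
   plus 1 if a = 0; in encoded entries, 0 stands for infinity. *)
Definition gap (Delta a b z : nat) : nat :=
  (b %/ Delta - a %/ Delta) + (a == 0) + (a %% Delta < z) - (b %% Delta <= z).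

Definition conflict (Delta a b z : nat) : nat :=
  if a < b then gap Delta a b z else if b < a then gap Delta b a z else 0.

Section Conflict.

Variables (Delta : nat).
Hypothesis Delta_gt0 : 0 < Delta.

Lemma ltn_divmod a b :
  (a < b) = (a %/ Delta < b %/ Delta) ||
            (a %/ Delta == b %/ Delta) && (a %% Delta < b %% Delta).
Proof.
have := divn_eq a Delta; have := divn_eq b Delta.
have := ltn_pmod a Delta_gt0; have := ltn_pmod b Delta_gt0.
move: (a %/ _) (a %% _) (b %/ _) (b %% _) => qa ra qb rb hb ha -> ->.
case: (ltngtP qa qb) => [h|h|->] /=.
- by have : qa.+1 * Delta <= qb * Delta; [rewrite leq_mul2r h orbT|rewrite mulSn; lia].
- have : qb.+1 * Delta <= qa * Delta by rewrite leq_mul2r h orbT.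
  by rewrite mulSn; lia.
- by rewrite ltn_add2l.
Qed.

(** The subtraction in [gap] is not truncated: for a < b with equal quotients, a mod Delta < b mod
    Delta, so the second bracket can be 1 only if the first is. *)
Lemma gap_add a b z : a < b ->
  gap Delta a b z + (b %% Delta <= z) =
  (b %/ Delta - a %/ Delta) + (a == 0) + (a %% Delta < z).
Proof.
move=> ab; rewrite /gap subnK //.
move: ab; rewrite ltn_divmod => /orP[h|/andP[_ h]]; first by lia.
by case: (leqP _ z) => // h'; rewrite (leq_trans h h'); lia.
Qed.

Lemma gap_eq0 a b z : a < b -> z < Delta ->
  gap Delta a b z = 0 <->
  0 < a /\ forall t, t %% Delta = z -> ~ (a < t /\ t < b).
Proof.
move=> ab zD; have E := gap_add z ab; split=> [g0|[a0 H]].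
  rewrite g0 in E; split.
    rewrite lt0n; apply/eqP => a0; move: E ab; rewrite (ltn_divmod a b) a0 div0n mod0n.
    by move: (b %/ _) (b %% _) => *; lia.
  move=> t tz [at_ tb]; move: E at_ tb; rewrite (ltn_divmod a) (ltn_divmod t) tz.
  by move: (a %/ _) (a %% _) (b %/ _) (b %% _) (t %/ _) => *; lia.
apply: contrapT => g0.
(* The least number above a with residue z; a nonzero gap puts it below b when a > 0. *)
pose t := (if a %% Delta < z then a %/ Delta else (a %/ Delta).+1) * Delta + z.
have tz : t %% Delta = z by rewrite modnMDl modn_small.
have tq : t %/ Delta = if a %% Delta < z then a %/ Delta else (a %/ Delta).+1.
  by rewrite /t divnMDl // (divn_small zD) addn0.
apply: (H t tz); rewrite (ltn_divmod a) (ltn_divmod t) tz tq.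
move: E ab; rewrite (ltn_divmod a b).
move: (ltn_pmod a Delta_gt0) (ltn_pmod b Delta_gt0) g0.
move: (gap _ _ _ _) (a %/ _) (a %% _) (b %/ _) (b %% _) => g qa ra qb rb.
by case: (ltnP ra z) => h; lia.
Qed.

Lemma conflict_eq0 a b z : z < Delta ->
  conflict Delta a b z = 0 <->
  (a == 0) = (b == 0) /\
  forall t, t %% Delta = z -> ~ (a < t /\ t < b) /\ ~ (b < t /\ t < a).
Proof.
move=> zD; rewrite /conflict; case: (ltngtP a b) => [ab|ba|->].
- split=> [/(gap_eq0 ab zD)[a0 H]|[ab0 H]].
    by split=> [|t /H]; lia.
  by apply/(gap_eq0 ab zD); split=> [|t /H]; lia.
- split=> [/(gap_eq0 ba zD)[a0 H]|[ab0 H]].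
    by split=> [|t /H]; lia.
  by apply/(gap_eq0 ba zD); split=> [|t /H]; lia.
- by split=> // _; split=> // t _; lia.
Qed.

End Conflict.

(** All numbers are encoded, that is, times plus 1. The shift respects betweenness and congruence,
    so a label t is tested at the residue of t + 1. *)
Definition clash (n Delta : nat) (e : nat -> nat -> nat) (v w z : nat) : nat :=
  \sum_(0 <= x < n) conflict Delta (e x v) (e x w) z.

(* The edge vw may be given the time D(u,v), and lies then at the end of a
   foremost path from u to v. *)
Definition good (n Delta : nat) (e : nat -> nat -> nat) (u v w : nat) : bool :=
  [&& 0 < e u w, e u w < e u v & clash n Delta e v w (e u v %% Delta) == 0].

Lemma clash_eq0 n Delta e v w z : 0 < Delta -> z < Delta ->
  clash n Delta e v w z = 0 <->
  forall x, x < n -> (e x v == 0) = (e x w == 0) /\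
  forall t, t %% Delta = z ->
    ~ (e x v < t /\ t < e x w) /\ ~ (e x w < t /\ t < e x v).
Proof.
move=> D0 zD; rewrite /clash big_mkord; split=> [/eqP|H].
  rewrite sum_nat_eq0 => /forallP H x xn.
  by apply/(conflict_eq0 D0 _ _ zD)/eqP/(implyP (H (Ordinal xn))).
by apply/eqP; rewrite sum_nat_eq0; apply/forallP => x; apply/implyP => _;
  apply/eqP/(conflict_eq0 D0 _ _ zD)/H.
Qed.

Definition ent (n : nat) (D : 'M[option nat]_n) (x y : nat) : nat :=
  oapp (fun u : 'I_n => oapp (fun v : 'I_n => encode_entry (D u v)) 0 (insub y))
    0 (insub x).

Lemma entE n (D : 'M[option nat]_n) (u v : 'I_n) :
  ent D u v = encode_entry (D u v).
Proof. by rewrite /ent !valK. Qed.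

(** * Foremost paths *)

Section Foremost.

Variables (n : nat) (G : temporal_graph n).

Lemma reaches_refl u : reaches_at G u u 0.
Proof. by exists [::]; split=> //; apply/and3P; split. Qed.

Lemma Fo_cases u v :
  (exists d, [/\ Fo G u v = Some d, reaches_at G u v d
     & forall t, reaches_at G u v t -> d <= t]) \/
  (Fo G u v = None /\ forall t, ~ reaches_at G u v t).
Proof.
rewrite mxE; case: eqP => [->|_].
  by left; exists 0; split=> //; apply: reaches_refl.
rewrite /foremost; case: pselect => [ex|nex].
  left; case: ex_minnP => d /asboolP h m; exists d; split=> // t rt.
  by apply: m; apply/asboolP.
by right; split=> // t rt; apply: nex; exists t; apply/asboolP.
Qed.

Lemma Fo_Some u v d : reaches_at G u v d ->
  (forall t, reaches_at G u v t -> d <= t) -> Fo G u v = Some d.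
Proof.
move=> rd m; case: (Fo_cases u v) => [[d' [-> rd' m']]|[_ /(_ d)] //].
by congr Some; apply/eqP; rewrite eqn_leq m // m'.
Qed.

Lemma Fo_None u v : (forall t, ~ reaches_at G u v t) -> Fo G u v = None.
Proof. by move=> H; case: (Fo_cases u v) => [[d [_ /H]]|[]]. Qed.

Lemma Fo_SomeP u v d : Fo G u v = Some d ->
  reaches_at G u v d /\ forall t, reaches_at G u v t -> d <= t.
Proof. by case: (Fo_cases u v) => [[d' [-> ? ?]] [<-]|[->]]. Qed.

Lemma Fo_NoneP u v : Fo G u v = None -> forall t, ~ reaches_at G u v t.
Proof. by case: (Fo_cases u v) => [[d' [->]]|[]]. Qed.

Local Notation trel := (fun a b : 'I_n * nat =>
  temporal_edge G a.1 b.1 b.2 && (a.2 < b.2)).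

Lemma last_unzip1 (a : 'I_n * nat) p : last a.1 (unzip1 p) = (last a p).1.
Proof. by elim: p a => //=. Qed.

Lemma last_unzip2 (a : 'I_n * nat) p : last a.2 (unzip2 p) = (last a p).2.
Proof. by elim: p a => //=. Qed.

Lemma path_times a p : path trel a p ->
  forall b, b \in p -> b.2 <= (last a p).2.
Proof.
elim: p a => //= c p IH a /andP[_ pp] b; rewrite inE => /predU1P[->|]; last exact: IH.
elim: p c pp {IH} => //= d p IH c /andP[/andP[_ lt] pp].
exact: leq_trans (ltnW lt) (IH _ pp).
Qed.

(** Paths may not repeat vertices. If v already lies on the path to w, the path is cut at v, where
    it arrives earlier; hence [t' <= t] instead of equality. *)
Lemma reaches_edge x w v a t : reaches_at G x w a -> a < t ->
  temporal_edge G w v t -> exists2 t', reaches_at G x v t' & t' <= t.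
Proof.
move=> [p [/and3P[pp up /eqP lp] ap]] at_ E.
have lastp : last (x, 0) p = (w, a).
  apply: (injective_projections (last (x, 0) p) (w, a)).
    by rewrite -last_unzip1.
  by rewrite -last_unzip2.
have [|vp] := boolP (v \in x :: unzip1 p); last first.
  exists t => //; exists (rcons p (v, t)); split; last first.
    by rewrite /arrival_time /unzip2 map_rcons last_rcons.
  apply/and3P; split.
  - by rewrite rcons_path pp lastp /= E.
  - by rewrite /unzip1 map_rcons -rcons_cons rcons_uniq vp.
  - by rewrite /unzip1 map_rcons last_rcons.
rewrite inE => /predU1P[->|]; first by exists 0 => //; apply: reaches_refl.
move=> /mapP[[v' tv] vp /= vE]; subst v'.
exists tv; last first.
  by have := path_times pp vp; rewrite lastp /= => h; apply: leq_trans h (ltnW _).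
move: vp pp up => /path.splitPr[p1 p2] pp up.
exists (rcons p1 (v, tv)); split; last first.
  by rewrite /arrival_time /unzip2 map_rcons last_rcons.
move: pp; rewrite -cat_rcons cat_path => /andP[pp _].
apply/and3P; split=> //; last by rewrite /unzip1 map_rcons last_rcons.
move: up; rewrite -cat_rcons /unzip1 map_cat -cat_cons cat_uniq.
by case/and3P.
Qed.

Lemma reaches_last x v t : x != v -> reaches_at G x v t ->
  exists w a, [/\ reaches_at G x w a, a < t & temporal_edge G w v t].
Proof.
move=> xv [p [+ ap]]; case/lastP: p ap => [|p [v' t']].
  by move=> _ /and3P[_ _ /eqP E]; rewrite /= in E; rewrite E eqxx in xv.
rewrite /arrival_time /unzip2 map_rcons last_rcons /= => -> /and3P[].
rewrite rcons_path /unzip1 map_rcons last_rcons -rcons_cons rcons_uniq /=.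
move=> /andP[pp /andP[E lt]] /andP[_ up] /eqP <-.
exists (last (x, 0) p).1, (last (x, 0) p).2; split=> //.
exists p; split; last by rewrite -last_unzip2.
by apply/and3P; split=> //; rewrite -last_unzip1.
Qed.

End Foremost.

Lemma temporal_edgeC n (G : temporal_graph n) u v t :
  temporal_edge G u v t = temporal_edge G v u t.
Proof. by rewrite /temporal_edge setUC. Qed.

Lemma pmodE t d Delta : 0 < t -> 0 < d ->
  (pmod t Delta == pmod d Delta) = (t == d %[mod Delta]).
Proof.
case: t d => [|t] [|d] // _ _; rewrite /pmod /= eqSS.
by rewrite -(addn1 t) -(addn1 d) eqn_modDr.
Qed.

(** * Necessity *)

Section Necessity.

Variables (n : nat) (D : 'M[option nat]_n) (Delta : nat) (G : temporal_graph n).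
Hypotheses (Delta_gt0 : 0 < Delta) (GD : realization D Delta G).

Lemma realization_edge (w v : 'I_n) (t d : nat) : 0 < d -> 0 < t ->
  t = d %[mod Delta] -> temporal_edge G w v d -> temporal_edge G w v t.
Proof.
move=> d0 t0 td /andP[eG lab]; rewrite /temporal_edge eG /= GD.1 //.
have -> : pmod t Delta = pmod d Delta by apply/eqP; rewrite pmodE // td.
by rewrite -GD.1.
Qed.

(** A foremost path to w is prolonged by the edge. In encoded entries, [<= t] means before time t
    and [<= t.+1] means by time t. *)
Lemma realization_step (x w v : 'I_n) (t : nat) : temporal_edge G w v t ->
  0 < ent D x w <= t -> 0 < ent D x v <= t.+1.
Proof.
rewrite !entE -GD.2 => E; case Ew: (Fo G x w) => [a|] //= ha.
have [ra _] := Fo_SomeP Ew.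
have [t' rt' t't] := reaches_edge ra ha E.
case Ev: (Fo G x v) => [b|] /=; last by have := Fo_NoneP Ev rt'.
have [_ /(_ _ rt')] := Fo_SomeP Ev; lia.
Qed.

(** The witness is the vertex before v on a foremost path from u. Its last edge recurs at all
    positive times congruent to D(u,v), in both directions, and [realization_step] at these times
    rules out every clash. *)
Lemma realization_good (u v : 'I_n) : u != v -> 0 < ent D u v ->
  exists w : 'I_n, good n Delta (ent D) u v w.
Proof.
move=> uv; rewrite entE; case DE: (D u v) => [d|] // _.
have [rd _] : reaches_at G u v d /\ forall t, reaches_at G u v t -> d <= t.
  by apply: Fo_SomeP; rewrite GD.2.
have [w [a [ra ad E]]] := reaches_last uv rd.
have d0 : 0 < d by lia.
exists w; rewrite /good.
have [b [Fb ba]] : exists b, Fo G u w = Some b /\ b <= a.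
  case Ew: (Fo G u w) => [b|]; last by have := Fo_NoneP Ew ra.
  by exists b; split=> //; apply: (Fo_SomeP Ew).2.
have -> : ent D u w = b.+1 by rewrite entE -GD.2 Fb.
have -> : ent D u v = d.+1 by rewrite entE DE.
rewrite [b.+1 < d.+1](leq_ltn_trans ba ad : b.+1 < d.+1) /=; apply/eqP.
apply/(clash_eq0 _ _ _ _ Delta_gt0 (ltn_pmod _ Delta_gt0)) => x xn.
have E' : temporal_edge G v w d by rewrite temporal_edgeC.
have lab (y z : 'I_n) t : 0 < t -> t = d %[mod Delta] ->
    temporal_edge G y z d -> 0 < ent D x y <= t -> 0 < ent D x z <= t.+1.
  by move=> t0 td Ed; exact: (@realization_step (Ordinal xn) _ _ _ (realization_edge d0 t0 td Ed)).
have fin (y z : 'I_n) : temporal_edge G y z d -> 0 < ent D x y -> 0 < ent D x z.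
  (* A time congruent to [d] and late enough for x to have reached y. *)
  move=> Ed exy; have h : 0 < ent D x y <= ent D x y * Delta + d by nia.
  by case/andP: (lab y z (ent D x y * Delta + d) (ltn_addl _ d0) (modnMDl _ _ _) Ed h).
split.
  move: (fin _ _ E) (fin _ _ E'); case: (ent D x w) => [|?]; case: (ent D x v) => [|?] //; lia.
(* Here t is an encoded time, congruent to d + 1. For t = 0 there is no preceding time, but no entry
   lies below it either. *)
move=> t td; have {}td : t.-1 = d %[mod Delta] \/ t = 0.
  case: t td => [|t] td; [by right|left].
  by apply/eqP; rewrite /= -(eqn_modDr 1) !addn1 td.
have key (y z : 'I_n) : temporal_edge G y z d -> 0 < ent D x y ->
    ~ (ent D x y < t /\ t < ent D x z).
  move=> Ed exy [yt tz]; case: td => [td|]; last by lia.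
  have := lab y z t.-1 _ td Ed _; lia.
split=> [[h1 h2]|[h1 h2]].
  case: (posnP (ent D x v)) => [h0|h0]; last exact: (key _ _ E' h0).
  have := fin _ _ E; lia.
case: (posnP (ent D x w)) => [h0|h0]; last exact: (key _ _ E h0).
have := fin _ _ E'; lia.
Qed.

End Necessity.

(** * Sufficiency *)

(** Total on arbitrary triples of numbers: an ill-formed one gives a set with fewer than two
    elements, which [list_edges] discards. *)
Definition ends (n : nat) (x : nat * nat * nat) : {set 'I_n} :=
  [set i : 'I_n | (val i == x.1.1) || (val i == x.1.2)].

Definition list_label (n Delta : nat) (L : seq (nat * nat * nat))
    (f : {set 'I_n}) (t : nat) : bool :=
  (0 < t) && has (fun x => (ends n x == f) && (pmod t Delta == x.2)) L.

Definition list_edges (n : nat) (L : seq (nat * nat * nat)) : {set {set 'I_n}} :=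
  [set f : {set 'I_n} | (#|f| == 2) && has (fun x => ends n x == f) L].

Lemma list_simple n L f : f \in list_edges n L -> #|f| = 2.
Proof. by rewrite inE => /andP[/eqP]. Qed.

Lemma list_label_pos n Delta L f t :
  f \in list_edges n L -> list_label Delta L f t -> 0 < t.
Proof. by move=> _ /andP[]. Qed.

Definition list_graph (n Delta : nat) (L : seq (nat * nat * nat)) :
    temporal_graph n :=
  TemporalGraph (@list_simple n L) (@list_label_pos n Delta L).

Lemma pmod_small t Delta : 0 < t <= Delta -> pmod t Delta = t.
Proof. by case: t => // t /= tD; rewrite /pmod modn_small. Qed.

Lemma pmod_bounds t Delta : 0 < Delta -> 0 < pmod t Delta <= Delta.
Proof. by move=> D0; rewrite /pmod /= ltn_pmod. Qed.

Lemma list_graph_periodic n Delta L :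
  0 < Delta -> periodic Delta (list_graph n Delta L).
Proof.
move=> D0 f t _ t0; rewrite /= /list_label t0.
by rewrite (pmod_small (pmod_bounds t D0)); case/andP: (pmod_bounds t D0) => ->.
Qed.

(** Two such times differ by a multiple of Delta, and a window of length Delta has room for only
    one. *)
Lemma count_pmod_le1 t0 Delta s :
  count (fun t => pmod t Delta == s) (iota t0.+1 Delta) <= 1.
Proof.
rewrite -size_filter; set F := filter _ _.
have uF : uniq F by rewrite filter_uniq // iota_uniq.
have eqF x y : x \in F -> y \in F -> x = y.
  rewrite !mem_filter !mem_iota => /andP[/eqP <- hx] /andP[/eqP E hy].
  wlog le_xy : x y hx hy E / x <= y => [W|].
    by case: (leqP x y) => [|/ltnW] le; [apply: W|apply/esym; apply: W].
  have : Delta %| y - x.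
    rewrite -eqn_mod_dvd //; apply/eqP; apply/eqP.
    by rewrite -pmodE ?E //; lia.
  by case/dvdnP=> [[|k]] ?; nia.
case: F uF eqF => [|x [|y F]] //= /andP[+ _] /(_ x y).
by rewrite !inE !eqxx /= orbT negb_or => /andP[/eqP h _] /(_ isT isT).
Qed.

(** Each triple accounts for at most one label per window, and only on its own edge. *)
Lemma labels_list_graph n Delta L t0 :
  labels_in_window (list_graph n Delta L) t0 Delta <= size L.
Proof.
rewrite /labels_in_window /=.
apply: (@leq_trans (\sum_(f : {set 'I_n}) \sum_(x <- L) (ends n x == f))).
  rewrite big_mkcond; apply: leq_sum => f _; case: ifP => // _.
  elim: L => [|x L IH].
    rewrite big_nil leqn0 (eq_count (a2 := pred0)) ?count_pred0 //.
    by move=> t; rewrite /list_label /= andbF.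
  set cx := count (fun t => (ends n x == f) && (pmod t Delta == x.2))
    (iota t0.+1 Delta).
  have cx1 : cx <= (ends n x == f).
    rewrite /cx; case: eqP => _ /=; first exact: count_pmod_le1.
    by rewrite (eq_count (a2 := pred0)) ?count_pred0.
  rewrite big_cons; apply: leq_trans (leq_add cx1 IH).
  rewrite /cx -count_predUI; apply: leq_trans (leq_addr _ _).
  apply: sub_count => t; rewrite /list_label /= andb_orr.
  by case/orP=> [/andP[_ ->] //|->]; rewrite orbT.
rewrite exchange_big /= -sum1_size; apply: leq_sum => x _.
rewrite (bigD1 (ends n x)) //= eqxx big1 // => f.
by rewrite eq_sym => /negbTE ->.
Qed.

Section Sufficiency.

Variables (n : nat) (D : 'M[option nat]_n) (Delta : nat).
Variable (L : seq (nat * nat * nat)).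
Hypotheses (Delta_gt0 : 0 < Delta) (distD : distance_matrix D).
Hypothesis L_ok : forall w v t, (w, v, t) \in L ->
  [/\ w < n, v < n, w != v, 0 < t <= Delta
    & clash n Delta (ent D) v w (t.+1 %% Delta) = 0].
Hypothesis L_full : forall u v : 'I_n, u != v -> 0 < ent D u v ->
  exists w : 'I_n, 0 < ent D u w < ent D u v /\
    (val w, val v, pmod (ent D u v).-1 Delta) \in L.

Let G := list_graph n Delta L.

Lemma ends_pair (u v : 'I_n) t : ends n (val u, val v, t) = [set u; v].
Proof. by apply/setP => i; rewrite !inE. Qed.

Lemma list_temporal_edge (u v : 'I_n) t : temporal_edge G u v t =
  (0 < t) && (((val u, val v, pmod t Delta) \in L) ||
              ((val v, val u, pmod t Delta) \in L)).
Proof.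
rewrite /temporal_edge inE /= /list_label; case: (posnP t) => [|t0]; first by rewrite !andbF.
apply/andP/orP => [[/andP[c2 _] /= /hasP[[[a b] s] xL /andP[/eqP E /eqP /= sE]]]|].
  have [aN bN ab _ _] := L_ok xL.
  move: E; rewrite (@ends_pair (Ordinal aN) (Ordinal bN) s) => E.
  have : u \in [set Ordinal aN; Ordinal bN] by rewrite E set21.
  have : v \in [set Ordinal aN; Ordinal bN] by rewrite E set22.
  have uv : u != v by move: c2; rewrite cards2; case: (u != v).
  rewrite !inE sE.
  move=> /orP[/eqP vE|/eqP vE] /orP[/eqP uE|/eqP uE];
    by [rewrite uE vE eqxx in uv|left; rewrite uE vE|right; rewrite uE vE].
move=> H; have [x [xL xE xv x2]] : exists x, [/\ x \in L, ends n x = [set u; v],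
    val u != val v & x.2 = pmod t Delta].
  case: H => xL; eexists; split; try exact: xL; try by [].
  - exact: ends_pair.
  - by case: (L_ok xL).
  - by rewrite ends_pair setUC.
  - by case: (L_ok xL) => _ _; rewrite eq_sym.
split; first rewrite cards2 (_ : u != v) //=.
  by apply/hasP; exists x => //; rewrite xE.
by apply/hasP; exists x => //; rewrite xE x2 !eqxx.
Qed.

Lemma list_represents : represents Delta L G.
Proof.
split=> [w v t /L_ok[] //|u v t tD].
by rewrite list_temporal_edge pmod_small //; case/andP: tD => ->.
Qed.

(** The inequality of [realization_step], here obtained from the absence of a clash: the encoded
    time t + 1 is not strictly between the entries of x at w and v. The condition is symmetric, so
    either orientation in the list serves. *)
Lemma list_step (x w v : 'I_n) t : temporal_edge G w v t ->
  0 < ent D x w <= t -> 0 < ent D x v <= t.+1.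
Proof.
rewrite list_temporal_edge => /andP[t0 H].
have [a [b [ab cl]]] : exists a b, ((a, b) = (w, v) \/ (a, b) = (v, w)) /\
    clash n Delta (ent D) b a (t.+1 %% Delta) = 0.
  have tE : t.+1 %% Delta = (pmod t Delta).+1 %% Delta.
    apply/eqP; rewrite -(addn1 t) -(addn1 (pmod _ _)) eqn_modDr.
    by rewrite -pmodE // (pmod_small (pmod_bounds t Delta_gt0)).
  rewrite tE; case/orP: H => /L_ok[_ _ _ _ h].
    by exists w, v; split=> //; left.
  by exists v, w; split=> //; right.
have := clash_eq0 n (ent D) b a Delta_gt0 (ltn_pmod t.+1 Delta_gt0).
move=> -[/(_ cl x (ltn_ord x))[e0 /(_ t.+1 erefl)[h1 h2]] _].
by case: ab => -[aE bE]; rewrite {}aE {}bE in e0 h1 h2; lia.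
Qed.

(** Induction along the path by [list_step], starting from D(u,u) = 0, which is encoded as 1. *)
Lemma list_reaches_ge (u v : 'I_n) t : reaches_at G u v t -> 0 < ent D u v <= t.+1.
Proof.
move=> [p [/and3P[pp _ /eqP lp] ap]].
have : 0 < ent D u (u, 0).1 <= (u, 0).2.+1.
  by rewrite entE ((distD u u).2 erefl).
rewrite -lp -ap /arrival_time (last_unzip1 (u, 0)) (last_unzip2 (u, 0)).
elim: p (u, 0) pp {lp ap} => //= b p IH a /andP[/andP[E ab] pp] ha.
by apply: IH => //; apply: list_step E _; lia.
Qed.

(** Strong induction on d: the listed neighbour w of v has a smaller entry, so it is reached before
    d, and the edge wv can then be taken at time d. *)
Lemma list_reaches (u v : 'I_n) d : ent D u v = d.+1 ->
  exists2 t, reaches_at G u v t & t <= d.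
Proof.
have [m] := ubnP d; elim: m d v => // m IH d v dm dE.
have [<-|uv] := eqVneq u v; first by exists 0 => //; apply: reaches_refl.
have [|w [wd wL]] := L_full uv; first by rewrite dE.
have [t rt tw] : exists2 t, reaches_at G u w t & t <= (ent D u w).-1.
  by apply: IH; lia.
apply: (reaches_edge rt (t := d)); first by lia.
rewrite list_temporal_edge; rewrite dE /= in wL.
by rewrite wL; lia.
Qed.

Lemma list_realization : realization D Delta G.
Proof.
split; first exact: list_graph_periodic.
apply/matrixP => u v; case DE: (D u v) => [d|].
  have [|t rt td] := @list_reaches u v d; first by rewrite entE DE.
  have ge t' : reaches_at G u v t' -> d <= t'.
    by move/list_reaches_ge; rewrite entE DE /=.
  have E : t = d by apply/eqP; rewrite eqn_leq td ge.
  by apply: Fo_Some => //; rewrite -E.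
by apply: Fo_None => t /list_reaches_ge; rewrite entE DE.
Qed.

End Sufficiency.

(** * The program *)

(* Arrays: 0 is the input, later the output; 1 the encoded matrix D; 2 holds
   w + 1 at (u, v) if vw has been chosen for D(u,v), else 0; 3 the sorted
   residues of column v; 4 and 5 the jumps of the step functions, upwards and
   downwards. Variables: vP = 2 ^ vL > n; [search] maps vz to its position vp in
   array 3. *)
Local Notation vn := 2.
Local Notation vD := 3.
Local Notation vL := 4.
Local Notation vP := 5.
Local Notation vv := 6.
Local Notation vw := 7.
Local Notation vx := 8.
Local Notation vy := 9.
Local Notation vr := 10.
Local Notation vk := 11.
Local Notation va := 12.
Local Notation vb := 13.
Local Notation vs := 14.
Local Notation vz := 15.
Local Notation vp := 16.
Local Notation vh := 17.
Local Notation vi := 18.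
Local Notation vok := 19.
Local Notation vc := 20.
Local Notation vt := 21.

Local Notation "c1 ;; c2" := (Seq c1 c2) (at level 60, right associativity).
Local Notation "x |+| y" := (Bin Add x y) (at level 50, left associativity).
Local Notation "x |-| y" := (Bin Defs.Sub x y) (at level 50, left associativity).
Local Notation "x |*| y" := (Bin Mul x y) (at level 40, left associativity).
Local Notation "x |/| y" := (Bin Div x y) (at level 40, left associativity).
Local Notation "x |%| y" := (Bin Mod x y) (at level 40, left associativity).
Local Notation entry a u v := (Ld a (V u |*| V vn |+| V v)).

(** [vp] counts entries known to be below [vz]. Since the array is sorted, the entry at
    [vp + vh - 1] tells whether the next [vh] entries are below it as well. *)
Definition search : cmd :=
  Asg vp (C 0) ;; Asg vh (V vP) ;;
  For vi vL false
    (Asg vh (V vh |/| C 2) ;;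
     Ifl (V vp |+| V vh) (V vn |+| C 1)
       (Ifl (Ld 3 (V vp |+| V vh |-| C 1)) (V vz) (Asg vp (V vp |+| V vh)) Skip)
       Skip).

Definition setup_log : cmd :=
  For vi vn true
    (Ifl (V vP) (V vn |+| C 1)
       (Asg vP (V vP |+| V vP) ;; Asg vL (V vL |+| C 1)) Skip).

Definition setup_copy : cmd :=
  For vx vn true (For vy vn true
    (Sto 1 (V vx |*| V vn |+| V vy) (Ld 0 (V vx |*| V vn |+| V vy |+| C 2)))).

(** Each residue is stored at its rank, ties being broken by the row index. This quadratic sort is
    done once per column, in total cubic time, which the bound permits. *)
Definition sort_column : cmd :=
  For vx vn true
    (Asg vr (C 0) ;; Asg vk (entry 1 vx vv |%| V vD) ;;
     For vy vn true
       (Ifl (entry 1 vy vv |%| V vD |*| V vn |+| V vy) (V vk |*| V vn |+| V vx)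
          (Asg vr (V vr |+| C 1)) Skip) ;;
     Sto 3 (V vr) (V vk)).

(** Positions run from 0 to n inclusive: a jump at n lies beyond all residues of the column. *)
Definition clear : cmd :=
  Sto 4 (V vn) (C 0) ;; Sto 5 (V vn) (C 0) ;; Asg vs (C 0) ;;
  For vx vn true (Sto 4 (V vx) (C 0) ;; Sto 5 (V vx) (C 0)).

(** [C 1 |-| V va] is the indicator of [va] = 0. The bracket [a mod Delta < z] switches on at the
    first entry that is at least a mod Delta + 1, and [b mod Delta <= z] at the first that is at
    least b mod Delta; these are the two searches. *)
Definition collect : cmd :=
  For vx vn true
    (Asg va (entry 1 vx vv) ;; Asg vb (entry 1 vx vw) ;;
     Ifl (V vb) (V va) (Asg vt (V va) ;; Asg va (V vb) ;; Asg vb (V vt)) Skip ;;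
     Ifl (V va) (V vb)
       (Asg vs (V vs |+| (V vb |/| V vD |-| V va |/| V vD |+| (C 1 |-| V va))) ;;
        Asg vz (V va |%| V vD |+| C 1) ;; search ;;
        Sto 4 (V vp) (Ld 4 (V vp) |+| C 1) ;;
        Asg vz (V vb |%| V vD) ;; search ;;
        Sto 5 (V vp) (Ld 5 (V vp) |+| C 1))
       Skip).

Definition prefix_sums : cmd :=
  For vx vn true
    (Asg vs (V vs |+| Ld 4 (V vx) |-| Ld 5 (V vx)) ;; Sto 4 (V vx) (V vs)).

Definition query : cmd :=
  For vx vn true
    (Asg va (entry 1 vx vv) ;; Asg vb (entry 1 vx vw) ;;
     Ifl (C 0) (V vb)
       (Ifl (V vb) (V va)
          (Asg vz (V va |%| V vD) ;; search ;;
           Ifl (Ld 4 (V vp)) (C 1)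
             (Sto 2 (V vx |*| V vn |+| V vv) (V vw |+| C 1)) Skip)
          Skip)
       Skip).

Definition parents : cmd :=
  For vv vn true
    (sort_column ;;
     For vw vn true (clear ;; collect ;; prefix_sums ;; query)).

(** [1 < va] selects the finite entries off the diagonal. As [va] is D + 1, the label ([va] - 2) mod
    Delta + 1 is the representative of D in {1, ..., Delta}. *)
Definition output : cmd :=
  Asg vok (C 1) ;; Asg vc (C 0) ;;
  For vx vn true (For vy vn true
    (Asg va (entry 1 vx vy) ;; Asg vb (entry 2 vx vy) ;;
     Ifl (C 1) (V va)
       (Ifl (C 0) (V vb)
          (Sto 0 (C 3 |*| V vc |+| C 2) (V vb |-| C 1) ;;
           Sto 0 (C 3 |*| V vc |+| C 3) (V vy) ;;
           Sto 0 (C 3 |*| V vc |+| C 4) ((V va |-| C 2) |%| V vD |+| C 1) ;;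
           Asg vc (V vc |+| C 1))
          (Asg vok (C 0)))
       Skip)) ;;
  Sto 0 (C 0) (V vok) ;; Sto 0 (C 1) (V vc).

Definition main : cmd :=
  Asg vD (Ld 0 (C 1)) ;; Asg vL (C 0) ;; Asg vP (C 1) ;;
  setup_log ;; setup_copy ;; parents ;; output.

Arguments wp : simpl never.

Definition out_list (M : nat -> nat) (c : nat) : seq (nat * nat * nat) :=
  mkseq (fun i => (M (3 * i + 2), M (3 * i + 3), M (3 * i + 4))) c.

Lemma eq_out_list M M' c : (forall i, 2 <= i < 3 * c + 2 -> M i = M' i) ->
  out_list M c = out_list M' c.
Proof.
move=> MM'; apply/eq_in_map => i; rewrite mem_iota => i_c.
by rewrite !MM' //; lia.
Qed.

Definition before (u0 v0 u v : nat) : bool := (u < u0) || (u == u0) && (v < v0).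

Lemma before_next u0 v0 u v : before u0 v0.+1 u v =
  before u0 v0 u v || (u == u0) && (v == v0).
Proof. by rewrite /before; lia. Qed.

(** * Verification of the program *)

Section Verification.

Variables (n Delta m S B : nat) (e : nat -> nat -> nat).
Hypothesis Delta_gt0 : 0 < Delta.
Hypothesis m_ge : n + Delta + 2 <= m.
Hypothesis S_def : S = 3 * (n * n) + n + 2.
Hypothesis B_ge : m * m * m * m <= B.
Hypothesis e_le : forall x y, x < n -> y < n -> e x y <= m.

Definition logb := (trunc_log 2 n).+1.
Definition bounds (b : bool) : nat := if b then n else logb.

Local Notation wpr := (wp S B bounds).

Lemma wp_seq c1 c2 Q s : wpr c1 (wpr c2 Q) s -> wpr (c1 ;; c2) Q s.
Proof. by []. Qed.

Lemma wp_asg r x Q s : okE S x s -> ev x s < B -> Q (setv s r (ev x s)) ->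
  wpr (Asg r x) Q s.
Proof. by []. Qed.

Lemma wp_sto a x y Q s : okE S x s -> okE S y s -> ev x s < S -> ev y s < B ->
  Q (seta s a (ev x s) (ev y s)) -> wpr (Sto a x y) Q s.
Proof. by []. Qed.

Lemma wp_ifl x y c1 c2 Q s : okE S x s -> okE S y s ->
  (ev x s < ev y s -> wpr c1 Q s) -> (ev y s <= ev x s -> wpr c2 Q s) ->
  wpr (Ifl x y c1 c2) Q s.
Proof. by move=> ? ? h1 h2; do 2 split=> //; case: ltnP. Qed.

Lemma wp_skip (Q : state -> Prop) s : Q s -> wpr Skip Q s.
Proof. by []. Qed.

Lemma m_ge3 : 2 < m. Proof. by lia. Qed.

Lemma small x : x <= m * m * m -> x < B.
Proof. by have := m_ge3; nia. Qed.

Lemma small1 x : x <= m -> x < B.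
Proof. by move=> h; apply: small; have := m_ge3; nia. Qed.

Lemma idx_lt u v : u < n -> v < n -> u * n + v < n * n.
Proof. by move=> un vn; have : u.+1 * n <= n * n; [rewrite leq_mul2r un orbT|rewrite mulSn; lia]. Qed.

Lemma idx_ltS u v : u < n -> v < n -> u * n + v < S.
Proof. by move=> un vn; have := idx_lt un vn; lia. Qed.

Lemma idx_inj u v u' v' : v < n -> v' < n ->
  (u * n + v == u' * n + v') = (u == u') && (v == v').
Proof.
move=> vn v'n; apply/eqP/andP => [E|[/eqP-> /eqP->] //].
by have [-> ->] := arr_inj vn v'n E.
Qed.

Definition ctx (s : state) : Prop :=
  [/\ var s vn = n, var s vD = Delta,
      var s vL <= logb /\ var s vP = 2 ^ var s vL, n < var s vP < B
    & forall u v, u < n -> v < n -> arr s 1 (u * n + v) = e u v].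

Lemma ctx_frame ms aas s s' : frame ms aas s s' ->
  [&& vn \notin ms, vD \notin ms, vL \notin ms, vP \notin ms & 1 \notin aas] ->
  ctx s -> ctx s'.
Proof.
move=> [h k] /and5P[a1 a2 a3 a4 a5] [? ? ? ? H]; split; rewrite ?h //.
by move=> u v un v_n; rewrite k // H.
Qed.

(** ** Binary search *)

Definition key (v x : nat) := e x v %% Delta.

Definition lb (v z : nat) : nat := \sum_(0 <= x < n) (key v x < z).

(** Sortedness in terms of thresholds, the form in which both the binary search and the positions of
    the jumps use it; no permutation has to be mentioned. *)
Definition sorted_col (q : nat -> nat) (v : nat) : Prop :=
  forall z i, i < n -> (q i < z) = (i < lb v z).

Lemma sum_le (F : nat -> nat) c k : (forall x, x < k -> F x <= c) ->
  \sum_(0 <= x < k) F x <= k * c.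
Proof.
move=> Fc; rewrite -[X in _ <= X * _]subn0 -sum_nat_const_nat !big_mkord.
by apply: leq_sum => x _; apply: Fc.
Qed.

Lemma sum_bool_le (P : nat -> bool) k : \sum_(0 <= x < k) P x <= k.
Proof.
by rewrite -[X in _ <= X]muln1; apply: sum_le => x _; case: (P x).
Qed.

Lemma lb_le v z : lb v z <= n.
Proof. exact: sum_bool_le. Qed.

(** The answer stays in the half-open interval from [vp] to [vp + vh], whose length is a power of 2
    above n at first and 1 at the end. *)
Lemma wp_search v s (Q : state -> Prop) : ctx s -> sorted_col (arr s 3) v ->
  (forall s', frame (mods search) (amods search) s s' ->
     var s' vp = lb v (var s vz) -> Q s') ->
  wpr search Q s.
Proof.
move=> cx sq HQ; have [n_ D_ [L_ P_] PB _] := cx.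
set z := var s vz; have lbn := lb_le v z.
have H : wpr search (fun s' => var s' vp = lb v z) s.
  apply/wp_seq/wp_asg => //=; first by apply: small1; lia.
  apply/wp_seq/wp_asg => //=; first by lia.
  apply: (@wp_for _ _ _ (fun j s' => [/\ var s' vh = 2 ^ (var s vL - j),
    var s' vp <= lb v z & lb v z < var s' vp + var s' vh])) => //=.
  - by rewrite subn0; split=> //; lia.
  - move=> j s' jL fr s'i [h1 h2 h3].
    have n' : var s' vn = n by rewrite fr.1.
    have z' : var s' vz = z by rewrite fr.1.
    have q' : arr s' 3 = arr s 3 by rewrite fr.2.
    have hE : var s' vh %/ 2 = 2 ^ (var s vL - j.+1).
      by rewrite h1 -(subnSK jL) expnS mulKn.
    have h2E : var s' vh = 2 * (var s' vh %/ 2).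
      by rewrite hE -expnS subnSK.
    have hpos : 0 < var s' vh %/ 2 by rewrite hE expn_gt0.
    apply/wp_seq/wp_asg => //=.
      by apply: leq_ltn_trans (leq_div _ _) _; rewrite h1; apply: leq_ltn_trans (leq_pexp2l _ (leq_subr _ _)) _ => //; lia.
    apply: wp_ifl => //=; rewrite n' => c1; last first.
      by apply: wp_skip => /=; split=> //; lia.
    apply: wp_ifl => //=; rewrite ?z' ?q' ?sq; try lia.
    + move=> c2; apply: wp_asg => //=; first by apply: small1; lia.
      by split=> //; lia.
    + rewrite leqNgt sq; last by lia.
      by move=> c2; apply: wp_skip => /=; split=> //; lia.
  - move=> s' fr; rewrite /= subnn expn0 => -[h1 h2 h3]; lia.
by apply: wp_mono (wp_frame H) => s' [h f]; apply: HQ.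
Qed.

(** ** Preparation *)

Lemma wp_setup_log s (Q : state -> Prop) :
  var s vn = n -> var s vL = 0 -> var s vP = 1 ->
  (forall s', frame (mods setup_log) (amods setup_log) s s' ->
     var s' vL <= logb -> var s' vP = 2 ^ var s' vL -> n < var s' vP < B -> Q s') ->
  wpr setup_log Q s.
Proof.
move=> n_ L_ P_ HQ.
(* The third clause says that no doubling has been skipped while [vP] is at most n; if it still were
   after n rounds, then 2 ^ n <= n. The fourth bounds [vL] by [logb]. *)
apply: (@wp_for _ _ _ (fun j s' => [/\ var s' vP = 2 ^ var s' vL, var s' vL <= j,
  var s' vP <= n -> var s' vL = j & var s' vL = 0 \/ 2 ^ (var s' vL).-1 <= n])) => //=.
- by rewrite n_.
- by rewrite L_ P_; split=> //; left.
- move=> j s' jn fr _ [h1 h2 h3 h4]; rewrite n_ in jn.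
  have n' : var s' vn = n by rewrite fr.1.
  apply: wp_ifl => //=; rewrite n' => c; last first.
    apply: wp_skip; split=> //=; first exact: leqW.
    by move=> h; lia.
  apply/wp_seq/wp_asg => //=; first by apply: small; nia.
  apply/wp_asg => //=; first by apply: small1; lia.
  rewrite addn1; split=> //=; first by rewrite h1 addnn -mul2n -expnS.
    by move=> h; rewrite h3 //; lia.
  by right; rewrite -h1; lia.
- move=> s' fr; rewrite n_ => -[h1 h2 h3 h4].
  apply: HQ => //.
    by case: h4 => [->//|h4]; rewrite /logb -ltnS; have := trunc_log_max (isT : 1 < 2) h4; lia.
  case: h4 => [h4|h4].
    rewrite h1 h4 in h3 *; rewrite small1 //; last by have := m_ge3; lia.
    by rewrite andbT expn0; case: (n) h3 => // k /(_ isT) <-.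
  apply/andP; split.
    rewrite ltnNge; apply/negP => h; have hL := h3 h.
    by have := ltn_expl n (isT : 1 < 2); rewrite -hL -h1; lia.
  have [L0|L0] := posnP (var s' vL).
    by rewrite h1 L0 small1 //; have := m_ge3; lia.
  rewrite h1 -(prednK L0) expnS; apply: small; nia.
Qed.

Lemma wp_setup_copy s (Q : state -> Prop) : var s vn = n ->
  (forall u v, u < n -> v < n -> arr s 0 (u * n + v + 2) = e u v) ->
  (forall s', frame (mods setup_copy) (amods setup_copy) s s' ->
     (forall u v, u < n -> v < n -> arr s' 1 (u * n + v) = e u v) -> Q s') ->
  wpr setup_copy Q s.
Proof.
move=> n_ inp HQ.
apply: (@wp_for _ _ _ (fun j s' => forall u v, u < j -> v < n ->
  arr s' 1 (u * n + v) = e u v)) => //=.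
- by rewrite n_.
- move=> j s' jn fr j' H; rewrite n_ in jn.
  have n' : var s' vn = n by rewrite fr.1.
  apply: (@wp_for _ _ _ (fun i s' => forall u v, u <= j -> v < n ->
    (u < j) || (v < i) -> arr s' 1 (u * n + v) = e u v)) => //=.
  + by rewrite n'.
  + by move=> u v uj v_n; rewrite orbF => uj'; apply: H.
  + move=> i s2 i_n fr2 i2 H2; rewrite n' in i_n.
    have n2 : var s2 vn = n by rewrite fr2.1 //= fr.1.
    have x2 : var s2 vx = j by rewrite fr2.1.
    have a2 : arr s2 0 = arr s 0 by rewrite fr2.2 //= fr.2.
    have := idx_lt jn i_n => lt.
    apply: wp_sto => //=; rewrite ?x2 ?n2 ?i2 ?a2 ?inp //.
    * by do !split=> //; lia.
    * by lia.
    * by apply: small1; apply: e_le.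
    move=> u v uj v_n c; rewrite idx_inj //.
    case: eqP => [uE|neq] /=; last by apply: H2 => //; lia.
    case: eqP => [vE|neq'] /=; first by rewrite uE vE.
    by apply: H2 => //; lia.
  + move=> s2 fr2; rewrite n' => H2 u v uj v_n; apply: H2 => //; lia.
- by move=> s' fr; rewrite n_; apply: HQ.
Qed.

(** ** Sorting a column *)

(** Orders the rows by residue, then by index; distinct rows get distinct weights. *)
Definition wt (v x : nat) := key v x * n + x.

Definition rank (v x : nat) : nat := \sum_(0 <= y < n) (wt v y < wt v x).

Lemma sum_bool_lt (P P' : nat -> bool) x : x < n ->
  (forall y, y < n -> P y -> P' y) -> ~~ P x -> P' x ->
  \sum_(0 <= y < n) P y < \sum_(0 <= y < n) P' y.
Proof.
move=> xn PP' Px P'x; rewrite !big_mkord (bigD1 (Ordinal xn)) //=.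
rewrite [X in _ < X](bigD1 (Ordinal xn)) //=.
rewrite (negbTE Px) P'x add0n add1n ltnS; apply: leq_sum => y _.
by case: (boolP (P y)) => // /PP' ->.
Qed.

Lemma sum_bool_sub (P P' : nat -> bool) :
  (forall y, y < n -> P y -> P' y) ->
  \sum_(0 <= y < n) P y <= \sum_(0 <= y < n) P' y.
Proof.
move=> PP'; rewrite !big_mkord; apply: leq_sum => y _.
by case: (boolP (P y)) => // /PP' ->.
Qed.

Lemma rank_lt v x : x < n -> rank v x < n.
Proof.
move=> xn; apply: leq_trans (sum_bool_le xpredT n).
by apply: (@sum_bool_lt _ _ x) => //; rewrite ltnn.
Qed.

Lemma rank_inj v x y : x < n -> y < n -> rank v x = rank v y -> x = y.
Proof.
move=> xn yn E; case: (ltngtP (wt v x) (wt v y)) => [h|h|/eqP].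
- have : rank v x < rank v y; last by rewrite E ltnn.
  by apply: (@sum_bool_lt _ _ x) => //; rewrite ?ltnn // => z _ /ltn_trans; apply.
- have : rank v y < rank v x; last by rewrite E ltnn.
  by apply: (@sum_bool_lt _ _ y) => //; rewrite ?ltnn // => z _ /ltn_trans; apply.
- by rewrite idx_inj // => /andP[_ /eqP].
Qed.

(** Ranks are injective, so each position is the rank of some x. Rows of smaller weight than x have
    residue at most [key v x], and rows of smaller residue have smaller weight; the two facts give
    the two implications. *)
Lemma rank_sorted q v : (forall x, x < n -> q (rank v x) = key v x) ->
  sorted_col q v.
Proof.
move=> qE z i i_n.
have [x xE] : exists x : 'I_n, rank v x = i.
  pose f (x : 'I_n) : 'I_n := Ordinal (rank_lt v (ltn_ord x)).
  have inj_f : injective f by move=> x y [/rank_inj E]; apply/val_inj/E.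
  have [g _ gK] := injF_bij inj_f; exists (g (Ordinal i_n)).
  by have := congr1 val (gK (Ordinal i_n)).
rewrite -xE qE //; apply/idP/idP => h.
  apply: (@sum_bool_lt _ _ x) => //; rewrite ?ltnn // => y yn.
  have key_le : wt v y < wt v x -> key v y <= key v x.
    rewrite /wt => h'; rewrite leqNgt; apply/negP => h2.
    have : (key v x).+1 * n <= key v y * n by rewrite leq_mul2r h2 orbT.
    by rewrite mulSn; have := ltn_ord x; lia.
  by move=> /key_le h2; apply: leq_ltn_trans h.
rewrite ltnNge; apply/negP => h2; move: h; rewrite ltnNge => /negP; apply.
apply: sum_bool_sub => y yn yz.
have : (key v y).+1 * n <= key v x * n by rewrite leq_mul2r (leq_trans yz h2) orbT.
by rewrite mulSn /wt; lia.
Qed.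

Lemma key_lt v x : key v x < Delta.
Proof. exact: ltn_pmod. Qed.

Lemma wp_sort_column v s (Q : state -> Prop) : ctx s -> var s vv = v -> v < n ->
  (forall s', frame (mods sort_column) (amods sort_column) s s' ->
     sorted_col (arr s' 3) v -> Q s') ->
  wpr sort_column Q s.
Proof.
move=> cx v_ v_n HQ; have [n_ _ _ _ _] := cx.
apply: (@wp_for _ _ _ (fun j s' => forall x, x < j ->
  arr s' 3 (rank v x) = key v x)) => //=.
- by rewrite n_.
- move=> j s' jn fr j' H; rewrite n_ in jn.
  have cx' : ctx s' by apply: ctx_frame fr _ cx.
  have [n' D' _ _ E'] := cx'.
  have v' : var s' vv = v by rewrite fr.1.
  apply/wp_seq/wp_asg => //=; first by apply: small1; lia.
  apply/wp_seq/wp_asg => //=; rewrite ?j' ?n' ?v' ?D' ?E' //.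
  + by do !split=> //; apply: idx_ltS.
  + by apply: small1; have := key_lt v j; rewrite /key; lia.
  apply: wp_seq.
  apply: (@wp_for _ _ _ (fun i s' => var s' vr =
    \sum_(0 <= y < i) (wt v y < wt v j))) => //=.
  + by rewrite n'.
  + by rewrite big_geq.
  + move=> i s2 i_n fr2 i2 H2; rewrite n' in i_n.
    have [n2 D2 _ _ E2] : ctx s2 by apply: ctx_frame fr2 _ cx'.
    have v2 : var s2 vv = v by rewrite fr2.1.
    have x2 : var s2 vx = j by rewrite fr2.1.
    have k2 : var s2 vk = key v j by rewrite fr2.1.
    apply: wp_ifl => //=; rewrite ?i2 ?n2 ?v2 ?D2 ?E2 ?x2 ?k2 ?H2 //.
    * by do !split=> //; apply: idx_ltS.
    * move=> c; apply: wp_asg => //=; rewrite H2.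
        by apply: small1; have := sum_bool_le (fun y => wt v y < wt v j) i; lia.
      by rewrite big_nat_recr //= [wt v i < _]c.
    * move=> c; apply: wp_skip => /=; rewrite H2 big_nat_recr //=.
      by rewrite [wt v i < _](negbTE _) ?addn0 // -leqNgt.
  + move=> s2 fr2; rewrite n' => H2.
    have k2 : var s2 vk = key v j by rewrite fr2.1.
    have a2 : arr s2 3 = arr s' 3 by rewrite fr2.2.
    apply: wp_sto => //=; rewrite ?H2 ?k2.
    * by have := rank_lt v jn; rewrite /rank; lia.
    * by apply: small1; have := key_lt v j; lia.
    move=> x; rewrite ltnS leq_eqVlt => /predU1P[->|xj]; first by rewrite eqxx.
    rewrite a2 H //; case: eqP => // /(rank_inj _ jn) E.
    by rewrite E //; lia.
- by move=> s' fr; rewrite n_ => H; apply: HQ => //; apply: rank_sorted.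
Qed.

(** ** Sweeping over an edge *)

Definition lo (v w x : nat) := minn (e x v) (e x w).
Definition hi (v w x : nat) := maxn (e x v) (e x w).

(** The part of the contribution of x that does not depend on the residue; [opens] and [closes]
    locate the jumps of the two brackets. *)
Definition base (v w x : nat) : nat :=
  if lo v w x < hi v w x
  then hi v w x %/ Delta - lo v w x %/ Delta + (lo v w x == 0) else 0.

Definition opens (v w i x : nat) : bool :=
  (lo v w x < hi v w x) && (lb v (lo v w x %% Delta + 1) == i).

Definition closes (v w i x : nat) : bool :=
  (lo v w x < hi v w x) && (lb v (hi v w x %% Delta) == i).

Lemma base_le v w x : v < n -> w < n -> x < n -> base v w x <= m.+1.
Proof.
move=> v_n w_n xn; rewrite /base; case: ifP => // _.
have him : hi v w x <= m by rewrite geq_max !e_le.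
rewrite -addn1 leq_add ?leq_b1 //.
exact: leq_trans (leq_subr _ _) (leq_trans (leq_div _ _) him).
Qed.

Lemma sum_pick (P : nat -> bool) (f : nat -> nat) k j :
  \sum_(0 <= i < j) \sum_(0 <= x < k) (P x && (f x == i)) =
  \sum_(0 <= x < k) (P x && (f x < j)).
Proof.
rewrite exchange_big /=; apply: eq_bigr => x _.
case: (P x) => /=; last by rewrite big1.
elim: j => [|j IH]; first by rewrite big_geq.
by rewrite big_nat_recr //= IH ltnS; case: ltngtP.
Qed.

(** Stated with sums on both sides, free of truncated subtraction. By [sorted_col], the jump of x
    has occurred by position j exactly when the bracket holds at [q j]; the identity then holds for
    each x separately, by [gap_add]. *)
Lemma sweep q v w j : sorted_col q v -> j < n ->
  \sum_(0 <= x < n) base v w x +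
    \sum_(0 <= i < j.+1) \sum_(0 <= x < n) opens v w i x =
  clash n Delta e v w (q j) +
    \sum_(0 <= i < j.+1) \sum_(0 <= x < n) closes v w i x.
Proof.
move=> sq jn; rewrite /opens /closes !sum_pick -!big_split /=.
apply: eq_bigr => x _; rewrite !ltnS ![lb _ _ <= j]leqNgt -!sq // -!leqNgt addn1.
have -> : conflict Delta (e x v) (e x w) (q j) =
    if lo v w x < hi v w x then gap Delta (lo v w x) (hi v w x) (q j) else 0.
  rewrite /conflict /lo /hi.
  by case: (ltngtP (e x v) (e x w)) => [h|h|->]; rewrite ?ltnn ?h.
rewrite /base; case: ifP => //= h.
by rewrite -(gap_add Delta_gt0 _ h).
Qed.

Lemma wp_clear s (Q : state -> Prop) : ctx s ->
  (forall s', frame (mods clear) (amods clear) s s' -> var s' vs = 0 ->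
     (forall i, i <= n -> arr s' 4 i = 0 /\ arr s' 5 i = 0) -> Q s') ->
  wpr clear Q s.
Proof.
move=> cx HQ; have [n_ _ _ _ _] := cx.
have H : wpr clear (fun s' => var s' vs = 0 /\
    forall i, i <= n -> arr s' 4 i = 0 /\ arr s' 5 i = 0) s.
  have B0 : 0 < B by apply: small1.
  apply/wp_seq/wp_sto => //=; first by lia.
  apply/wp_seq/wp_sto => //=; first by lia.
  apply/wp_seq/wp_asg => //=.
  apply: (@wp_for _ _ _ (fun j s' => forall i, (i < j) || (i == n) ->
    arr s' 4 i = 0 /\ arr s' 5 i = 0)) => //=.
  - by rewrite n_.
  - by move=> i /= /eqP->; rewrite n_ !eqxx.
  - move=> j s' jn fr j' H; rewrite n_ in jn.
    apply/wp_seq/wp_sto => //=; first by rewrite j'; lia.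
    apply/wp_sto => //=; first by rewrite j'; lia.
    move=> i ij; rewrite j'; case: eqP => // neq; apply: H; lia.
  - move=> s' fr; rewrite n_ => H; split; first by rewrite fr.1.
    by move=> i i_n; apply: H; lia.
by apply: wp_mono (wp_frame H) => s' [[h1 h2] f]; apply: HQ.
Qed.

Lemma wp_collect v w s (Q : state -> Prop) : ctx s -> sorted_col (arr s 3) v ->
  var s vv = v -> v < n -> var s vw = w -> w < n ->
  var s vs = 0 -> (forall i, i <= n -> arr s 4 i = 0 /\ arr s 5 i = 0) ->
  (forall s', frame (mods collect) (amods collect) s s' ->
     var s' vs = \sum_(0 <= x < n) base v w x ->
     (forall i, i <= n -> arr s' 4 i = \sum_(0 <= x < n) opens v w i x /\
                          arr s' 5 i = \sum_(0 <= x < n) closes v w i x) ->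
     Q s') ->
  wpr collect Q s.
Proof.
move=> cx sq v_ v_n w_ w_n s0 ud0 HQ; have [n_ _ _ _ _] := cx.
apply: (@wp_for _ _ _ (fun j s' => var s' vs = \sum_(0 <= x < j) base v w x /\
  forall i, i <= n -> arr s' 4 i = \sum_(0 <= x < j) opens v w i x /\
                      arr s' 5 i = \sum_(0 <= x < j) closes v w i x)) => //=.
- by rewrite n_.
- rewrite s0 !big_geq //; split=> // i i_n; rewrite !big_geq //; exact: ud0.
- move=> j s' jn fr j' [Hs Hud]; rewrite n_ in jn.
  have cx' : ctx s' by apply: ctx_frame fr _ cx.
  have [n' D' _ _ E'] := cx'.
  have v' : var s' vv = v by rewrite fr.1.
  have w' : var s' vw = w by rewrite fr.1.
  have q' : arr s' 3 = arr s 3 by rewrite fr.2.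
  have evB : e j v < B by apply: small1; apply: e_le.
  have ewB : e j w < B by apply: small1; apply: e_le.
  apply/wp_seq/wp_asg => //=; rewrite ?j' ?n' ?v' ?E' //.
    by do !split=> //; apply: idx_ltS.
  apply/wp_seq/wp_asg => //=; rewrite ?j' ?n' ?w' ?E' //.
    by do !split=> //; apply: idx_ltS.
  apply: wp_seq; set s1 := setv _ _ _.
  have H1 : wpr (Ifl (V vb) (V va) (Asg vt (V va) ;; Asg va (V vb) ;;
      Asg vb (V vt)) Skip) (fun s2 => var s2 va = lo v w j /\
      var s2 vb = hi v w j) s1.
    apply: wp_ifl => //=; rewrite /s1 /= => c.
      apply/wp_seq/wp_asg => //=; apply/wp_seq/wp_asg => //=; apply/wp_asg => //=.
      by rewrite /lo /hi; lia.
    by apply: wp_skip => /=; rewrite /lo /hi; lia.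
  apply: wp_mono (wp_frame H1) => s2 [[a2 b2] fr2].
  have cx2 : ctx s2 by apply: ctx_frame fr2 _ cx'.
  have [n2 D2 _ _ E2] := cx2.
  have x2 : var s2 vx = j by rewrite fr2.1.
  have vs2 : var s2 vs = var s' vs by rewrite fr2.1.
  have arr2 : arr s2 = arr s' by apply/funext => a; rewrite fr2.2.
  have hiB : hi v w j < B by rewrite gtn_max evB ewB.
  have sB : var s' vs + base v w j < B.
    rewrite Hs -big_nat_recr //=; apply: small.
    apply: leq_trans (sum_le (c := m.+1) _) _; last by nia.
    by move=> x xj; apply: base_le => //; lia.
  apply: wp_ifl => //=; rewrite a2 b2 => c; last first.
    have base0 : base v w j = 0 by rewrite /base ltnNge c.
    apply: wp_skip => /=; rewrite vs2 arr2 Hs big_nat_recr //= base0 addn0.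
    split=> // i i_n.
    by rewrite !big_nat_recr //= /opens /closes ltnNge c !addn0; apply: Hud.
  have baseE : hi v w j %/ Delta - lo v w j %/ Delta + (1 - lo v w j) = base v w j.
    by rewrite /base c; case: (lo v w j) => [|?]; rewrite ?subn0 //; lia.
  apply/wp_seq/wp_asg => //=; rewrite ?vs2 ?a2 ?b2 ?D2 baseE //.
  have lt_lo := ltn_pmod (lo v w j) Delta_gt0.
  have lt_hi := ltn_pmod (hi v w j) Delta_gt0.
  apply/wp_seq/wp_asg => //=; rewrite ?vs2 ?a2 ?b2 ?D2 ?baseE //.
    by apply: small1; lia.
  apply: wp_seq; apply: (@wp_search v) => //=; first by rewrite arr2 q'.
  move=> s3 fr3 p3; have arr3 : arr s3 = arr s' by rewrite -arr2; apply/funext => a; rewrite fr3.2.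
  have cx3 : ctx s3 by apply: ctx_frame fr3 _ cx2.
  have [_ D3 _ _ _] := cx3.
  have b3 : var s3 vb = hi v w j by rewrite fr3.1.
  have := lb_le v (lo v w j %% Delta + 1) => lb1.
  have := lb_le v (hi v w j %% Delta) => lb2.
  have [ub1 ub2] : \sum_(0 <= x < j) opens v w (lb v (lo v w j %% Delta + 1)) x <= j /\
    \sum_(0 <= x < j) closes v w (lb v (hi v w j %% Delta)) x <= j by split; apply: sum_bool_le.
  apply/wp_seq/wp_sto => //=; rewrite ?p3 ?arr3 ?(Hud _ lb1).1.
  - by do !split=> //; lia.
  - by lia.
  - by apply: small1; lia.
  apply/wp_seq/wp_asg => //=; rewrite ?b3 ?D3; first by apply: small1; lia.
  apply: wp_seq; apply: (@wp_search v) => //=; first by rewrite arr3 q'.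
  move=> s4 fr4 p4.
  have arr4 a : arr s4 a = (if eqn a 4 then arr (seta s3 4 (lb v (lo v w j %% Delta + 1)) (\sum_(0 <= x < j) opens v w (lb v (lo v w j %% Delta + 1)) x + 1)) 4 else arr s' a).
    rewrite fr4.2 //=; apply/funext => i; rewrite -arr3; case: eqnP => [->|] //.
  apply/wp_sto => //=; rewrite ?p4 ?arr4 /= ?arr3 ?(Hud _ lb2).2.
  - by do !split=> //; lia.
  - by lia.
  - by apply: small1; lia.
  split; first by rewrite fr4.1 //= fr3.1 //= Hs big_nat_recr.
  move=> i i_n; rewrite !big_nat_recr //= -(Hud _ i_n).1 -(Hud _ i_n).2.
  rewrite /opens /closes c /= ![_ == i]eq_sym.
  split; case: eqP => [->|_]; rewrite ?addn0 //.
    by rewrite (Hud _ lb1).1.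
  by rewrite (Hud _ lb2).2.
- by move=> s' fr; rewrite n_ => -[H1 H2]; apply: HQ.
Qed.

Lemma wp_prefix_sums v w s (Q : state -> Prop) : ctx s ->
  sorted_col (arr s 3) v -> v < n -> w < n ->
  var s vs = \sum_(0 <= x < n) base v w x ->
  (forall i, i <= n -> arr s 4 i = \sum_(0 <= x < n) opens v w i x /\
                       arr s 5 i = \sum_(0 <= x < n) closes v w i x) ->
  (forall s', frame (mods prefix_sums) (amods prefix_sums) s s' ->
     (forall i, i < n -> arr s' 4 i = clash n Delta e v w (arr s 3 i)) -> Q s') ->
  wpr prefix_sums Q s.
Proof.
move=> cx sq v_n w_n s0 ud HQ; have [n_ _ _ _ _] := cx.
apply: (@wp_for _ _ _ (fun j s' =>
  [/\ var s' vs + \sum_(0 <= i < j) \sum_(0 <= x < n) closes v w i x =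
      \sum_(0 <= x < n) base v w x +
        \sum_(0 <= i < j) \sum_(0 <= x < n) opens v w i x,
      forall i, i < j -> arr s' 4 i = clash n Delta e v w (arr s 3 i)
    & forall i, j <= i < n -> arr s' 4 i = arr s 4 i])) => //=.
- by rewrite n_.
- by split=> //; rewrite s0 /index_iota subnn !big_nil.
- move=> j s' jn fr j' [Hs H1 H2]; rewrite n_ in jn.
  have E4 : arr s' 4 j = \sum_(0 <= x < n) opens v w j x.
    by rewrite H2 ?(ud _ (ltnW jn)).1 //; lia.
  have E5 : arr s' 5 j = \sum_(0 <= x < n) closes v w j x.
    by rewrite fr.2 // (ud _ (ltnW jn)).2.
  have sw := sweep w sq jn.
  have clB : clash n Delta e v w (arr s 3 j) < B.
    apply: small; apply: leq_trans (leq_addr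
      (\sum_(0 <= i < j.+1) \sum_(0 <= x < n) closes v w i x) _) _.
    rewrite -sw /opens sum_pick; set X := \sum_(_ <= _ < _) nat_of_bool _.
    have X_le : X <= n by apply: sum_bool_le.
    have Y_le : \sum_(0 <= x < n) base v w x <= n * m.+1.
      by apply: sum_le => x xn; apply: base_le.
    by have := m_ge3; nia.
  (* By [sweep] the subtrahend does not exceed the sum before it, so the subtraction is exact. *)
  have valE : var s' vs + arr s' 4 j - arr s' 5 j = clash n Delta e v w (arr s 3 j).
    by move: sw; rewrite !(big_nat_recr j) //= E4 E5; lia.
  apply/wp_seq/wp_asg => //=; rewrite ?j' ?valE //.
    by do !split=> //; lia.
  apply/wp_sto => //=; rewrite ?j' //; first by lia.
  split=> [|i ij|i ij].
  + by rewrite -sw.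
  + case: eqP => [->|neq] //; apply: H1; lia.
  + rewrite ifF; last by apply/eqP; lia.
    by apply: H2; lia.
- by move=> s' fr; rewrite n_ => -[_ H _]; apply: HQ.
Qed.

(** ** Choosing last edges *)

(** The order of the nested loops: v outermost, then w, then u. *)
Definition done (v0 w0 u0 u v w : nat) : bool :=
  (v < v0) || (v == v0) && ((w < w0) || (w == w0) && (u < u0)).

(** A later good w overwrites an earlier one, so the last clause claims only that some choice has
    been recorded. *)
Definition parent_inv (A : nat -> nat) (v0 w0 u0 : nat) : Prop :=
  forall u v, u < n -> v < n ->
  [/\ A (u * n + v) <= n,
      0 < A (u * n + v) -> good n Delta e u v (A (u * n + v)).-1
    & forall w, w < n -> done v0 w0 u0 u v w -> good n Delta e u v w ->
      0 < A (u * n + v)].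

Lemma parent_inv_next (A : nat -> nat) v0 w0 u0 v1 w1 u1 :
  (forall u v w, u < n -> v < n -> w < n ->
     done v1 w1 u1 u v w -> done v0 w0 u0 u v w) ->
  parent_inv A v0 w0 u0 -> parent_inv A v1 w1 u1.
Proof.
move=> sub H u v un v_n; have [h1 h2 h3] := H u v un v_n; split=> // w wn dn.
by apply: h3 => //; apply: sub.
Qed.

Lemma wp_query v w s (Q : state -> Prop) : ctx s -> sorted_col (arr s 3) v ->
  var s vv = v -> v < n -> var s vw = w -> w < n ->
  (forall i, i < n -> arr s 4 i = clash n Delta e v w (arr s 3 i)) ->
  parent_inv (arr s 2) v w 0 ->
  (forall s', frame (mods query) (amods query) s s' ->
     parent_inv (arr s' 2) v w n -> Q s') ->
  wpr query Q s.
Proof.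
move=> cx sq v_ v_n w_ w_n cov PI HQ; have [n_ _ _ _ _] := cx.
apply: (@wp_for _ _ _ (fun j s' => parent_inv (arr s' 2) v w j)) => //=.
- by rewrite n_.
- move=> j s' jn fr j' H; rewrite n_ in jn.
  have cx' : ctx s' by apply: ctx_frame fr _ cx.
  have [n' D' _ _ E'] := cx'.
  have v' : var s' vv = v by rewrite fr.1.
  have w' : var s' vw = w by rewrite fr.1.
  have a3' : arr s' 3 = arr s 3 by rewrite fr.2.
  have a4' : arr s' 4 = arr s 4 by rewrite fr.2.
  have evB : e j v < B by apply: small1; apply: e_le.
  have ewB : e j w < B by apply: small1; apply: e_le.
  have bad A : A = arr s' 2 -> ~~ good n Delta e j v w ->
      parent_inv A v w j.+1.
    move=> -> ng u v2 un v2n; have [h1 h2 h3] := H u v2 un v2n; split=> //.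
    move=> w2 w2n; rewrite /done ltnS [u <= j]leq_eqVlt => dn g.
    apply: (h3 w2) => //; move: dn; rewrite /done.
    case: (v2 =P v) => [vE|] //=; case: (w2 =P w) => [wE|] //=.
    case: (u =P j) => [uE|] //=.
    by move: ng; rewrite -uE -vE -wE g.
  apply/wp_seq/wp_asg => //=; rewrite ?j' ?n' ?v' ?E' //.
    by do !split=> //; apply: idx_ltS.
  apply/wp_seq/wp_asg => //=; rewrite ?j' ?n' ?w' ?E' //.
    by do !split=> //; apply: idx_ltS.
  apply: wp_ifl => //= c1; last by refine (wp_skip _); apply: bad => //; rewrite /good; lia.
  apply: wp_ifl => //= c2; last by refine (wp_skip _); apply: bad => //; rewrite /good; lia.
  have lt_z := ltn_pmod (e j v) Delta_gt0.
  apply/wp_seq/wp_asg => //=; rewrite D'; first by apply: small1; lia.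
  apply/wp_seq; apply: (@wp_search v) => //=; first by rewrite a3'.
  move=> s2 fr2 p2.
  (* Row j itself contributes its residue to column v, so the search ends at an equal entry and not
     merely at a larger one. *)
  have q_lb : lb v (e j v %% Delta) < n /\
      arr s 3 (lb v (e j v %% Delta)) = e j v %% Delta.
    have lt : lb v (e j v %% Delta) < lb v (e j v %% Delta).+1.
      apply: (@sum_bool_lt _ _ j) => //; rewrite -/(key v j) ?ltnn ?ltnS //.
      by move=> y _ /ltnW.
    have lt_n := leq_trans lt (lb_le v _); split=> //.
    have h1 : arr s 3 (lb v (e j v %% Delta)) < (e j v %% Delta).+1 by rewrite sq.
    have h2 : ~~ (arr s 3 (lb v (e j v %% Delta)) < e j v %% Delta).
      by rewrite sq // ltnn.
    by apply/eqP; rewrite eqn_leq -ltnS h1 leqNgt h2.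
  have [lt_n qE] := q_lb.
  have arr2 a : arr s2 a = arr s' a by rewrite fr2.2.
  apply: wp_ifl => //=; rewrite ?p2 ?arr2 ?a4' ?cov // ?qE.
  + by split=> //; lia.
  + move=> c3; have [n2 _ _ _ _] : ctx s2 by apply: ctx_frame fr2 _ cx'.
    have v2 : var s2 vv = v by rewrite fr2.1.
    have w2 : var s2 vw = w by rewrite fr2.1.
    have x2 : var s2 vx = j by rewrite fr2.1.
    have gjvw : good n Delta e j v w by rewrite /good c1 c2 -leqn0 -ltnS.
    apply: wp_sto => //=; rewrite ?x2 ?n2 ?v2 ?w2.
    * exact: idx_ltS.
    * by apply: small1; lia.
    move=> u v3 un v3n; rewrite idx_inj // arr2.
    case: (u =P j) => [uE|neq] /=; last first.
      have [h1 h2 h3] := H u v3 un v3n; split=> // w3 w3n dn; apply: h3 => //.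
      by move: dn; rewrite /done; lia.
    case: (v3 =P v) => [vE|neq] /=.
      split; rewrite ?addn1 //= => _; by rewrite uE vE.
    have [h1 h2 h3] := H u v3 un v3n; split=> // w3 w3n dn; apply: h3 => //.
    by move: dn; rewrite /done; lia.
  + move=> c3; refine (wp_skip _); apply: bad; first exact: arr2.
    by rewrite /good c1 c2 -lt0n.
- by move=> s' fr; rewrite n_ => H; apply: HQ.
Qed.

Lemma wp_parents s (Q : state -> Prop) : ctx s -> (forall i, arr s 2 i = 0) ->
  (forall s', frame (mods parents) (amods parents) s s' ->
     parent_inv (arr s' 2) n 0 0 -> Q s') ->
  wpr parents Q s.
Proof.
move=> cx A0 HQ; have [n_ _ _ _ _] := cx.
apply: (@wp_for _ _ _ (fun j s' => parent_inv (arr s' 2) j 0 0)) => //=.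
- by rewrite n_.
- by move=> u v un v_n /=; rewrite A0; split=> // w wn; rewrite /done; lia.
- move=> v s' v_n fr v' H; rewrite n_ in v_n.
  have cx' : ctx s' by apply: ctx_frame fr _ cx.
  have [n' _ _ _ _] := cx'.
  apply/wp_seq; apply: wp_sort_column => //; first by rewrite v'.
  move=> s2 fr2; rewrite v' => sq.
  have cx2 : ctx s2 by apply: ctx_frame fr2 _ cx'.
  have [n2 _ _ _ _] := cx2.
  have v2 : var s2 vv = v by rewrite fr2.1.
  have a2 : arr s2 2 = arr s' 2 by rewrite fr2.2.
  apply: (@wp_for _ _ _ (fun j s' => parent_inv (arr s' 2) v j 0)) => //=.
  + by rewrite n2.
  + by rewrite a2.
  + move=> w s3 w_n fr3 w3 H3; rewrite n2 in w_n.
    have cx3 : ctx s3 by apply: ctx_frame fr3 _ cx2.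
    have v3 : var s3 vv = v by rewrite fr3.1.
    have q3 : arr s3 3 = arr s2 3 by rewrite fr3.2.
    apply/wp_seq; apply: wp_clear => // s4 fr4 s40 z4.
    have cx4 : ctx s4 by apply: ctx_frame fr4 _ cx3.
    have sq4 : sorted_col (arr s4 3) v by rewrite fr4.2 // q3.
    have v4 : var s4 vv = v by rewrite fr4.1.
    have w4 : var s4 vw = w by rewrite fr4.1.
    apply/wp_seq; apply: (@wp_collect v w) => // s5 fr5 vs5 ud5.
    have cx5 : ctx s5 by apply: ctx_frame fr5 _ cx4.
    have sq5 : sorted_col (arr s5 3) v by rewrite fr5.2.
    apply/wp_seq; apply: (@wp_prefix_sums v w) => // s6 fr6 cov6.
    have cx6 : ctx s6 by apply: ctx_frame fr6 _ cx5.
    have a6 : arr s6 3 = arr s5 3 by rewrite fr6.2.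
    apply: (@wp_query v w) => //; rewrite ?a6 //.
    * by rewrite fr6.1 // fr5.1.
    * by rewrite fr6.1 // fr5.1.
    * by rewrite fr6.2 // fr5.2 // fr4.2.
    move=> s7 fr7 H7 /=; apply: parent_inv_next H7 => u v7 w7 un _ _.
    by rewrite /done; lia.
  + move=> s3 fr3; rewrite n2 => H3 /=; apply: parent_inv_next H3 => u v3 w3 un v3n w3n.
    by rewrite /done; lia.
- by move=> s' fr; rewrite n_ => H; apply: HQ.
Qed.

(** ** Writing the result *)

Definition triple (A : nat -> nat) (u v : nat) : nat * nat * nat :=
  (A (u * n + v) - 1, v, (e u v - 2) %% Delta + 1).

(** The first clause keeps the output inside its array and finally yields the bound n^2 on the
    number of labels. The flag [ok] records whether every pair treated so far has a last edge. *)
Definition out_inv (A M : nat -> nat) (c ok u0 v0 : nat) : Prop :=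
  [/\ c <= u0 * n + v0,
      forall x, x \in out_list M c ->
        exists u v, [/\ u < n, v < n, 1 < e u v, 0 < A (u * n + v) & x = triple A u v],
      forall u v, u < n -> v < n -> before u0 v0 u v -> 1 < e u v ->
        0 < A (u * n + v) -> triple A u v \in out_list M c
    & exists2 b : bool, ok = b & b <-> forall u v, u < n -> v < n ->
        before u0 v0 u v -> 1 < e u v -> 0 < A (u * n + v)].

Lemma out_inv_next A M c ok u0 v0 u1 v1 : u0 * n + v0 = u1 * n + v1 ->
  (forall u v, u < n -> v < n -> before u0 v0 u v = before u1 v1 u v) ->
  out_inv A M c ok u0 v0 -> out_inv A M c ok u1 v1.
Proof.
move=> E eqb [h1 h2 h3 [b h4 h5]]; split=> //; first by rewrite -E.
  by move=> u v un v_n; rewrite -eqb //; apply: h3.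
exists b => //; split=> [/h5 H u v un v_n|H]; first by rewrite -eqb //; apply: H.
by apply/h5 => u v un v_n; rewrite eqb //; apply: H.
Qed.

Lemma wp_output s (Q : state -> Prop) : ctx s ->
  (forall i, i < n * n -> arr s 2 i <= n) ->
  (forall s', out_inv (arr s 2) (arr s' 0) (arr s' 0 1) (arr s' 0 0) n 0 -> Q s') ->
  wpr output Q s.
Proof.
move=> cx A_le HQ; have [n_ _ _ _ _] := cx; set A := arr s 2.
have B1 : 1 < B by apply: small1; lia.
have B0 : 0 < B by lia.
apply/wp_seq/wp_asg => //=; apply/wp_seq/wp_asg => //=; apply: wp_seq.
apply: (@wp_for _ _ _ (fun j s' =>
  out_inv A (arr s' 0) (var s' vc) (var s' vok) j 0)) => //=.
- by rewrite n_.
- split=> // [u v _ _|]; first by rewrite /before; lia.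
  by exists true => //; split=> // _ u v _ _; rewrite /before; lia.
- move=> j s' jn fr j' H; rewrite n_ in jn.
  have cx' : ctx s' by apply: ctx_frame fr _ cx.
  have [n' _ _ _ _] := cx'.
  apply: (@wp_for _ _ _ (fun i s' =>
    out_inv A (arr s' 0) (var s' vc) (var s' vok) j i)) => //=.
  + by rewrite n'.
  + move=> i s2 i_n fr2 i2 H2; rewrite n' in i_n.
    have cx2 : ctx s2 by apply: ctx_frame fr2 _ cx'.
    have [n2 D2 _ _ E2] := cx2.
    have x2 : var s2 vx = j by rewrite fr2.1.
    have A2 : arr s2 2 = A by rewrite fr2.2 // fr.2.
    have idx := idx_lt jn i_n.
    apply/wp_seq/wp_asg => //=; rewrite ?x2 ?i2 ?n2 ?E2 //.
    * by do !split=> //; lia.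
    * by apply: small1; apply: e_le.
    apply/wp_seq/wp_asg => //=; rewrite ?x2 ?i2 ?n2 ?A2 //.
    * by do !split=> //; lia.
    * by apply: small1; apply: leq_trans (A_le _ idx) _; lia.
    case: H2 => [c_le h2 h3 [b okE h4]].
    apply: wp_ifl => //= c1; last first.
      refine (wp_skip _) => /=; split=> //; first by lia.
        move=> u v un v_n; rewrite before_next => /orP[|/andP[/eqP-> /eqP->]].
          exact: h3.
        by lia.
      exists b => //; split=> [/h4 H4 u v un v_n|H4].
        rewrite before_next => /orP[|/andP[/eqP-> /eqP->]]; [exact: H4|lia].
      by apply/h4 => u v un v_n bf; apply: H4 => //; rewrite before_next bf.
    apply: wp_ifl => //= c2; last first.
      apply: wp_asg => //=; split=> //; first by lia.
        move=> u v un v_n; rewrite before_next => /orP[|/andP[/eqP-> /eqP->]].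
          exact: h3.
        by lia.
      exists false => //; split=> // H4.
      by have := H4 j i jn i_n; rewrite before_next !eqxx orbT => /(_ isT c1); lia.
    have lt_mod := ltn_pmod (e j i - 2) Delta_gt0.
    apply/wp_seq/wp_sto => //=; first by lia.
      by apply: small1; apply: leq_trans (leq_subr _ _) (leq_trans (A_le _ idx) _); lia.
    apply/wp_seq/wp_sto => //=; first by lia.
      by rewrite i2; apply: small1; lia.
    apply/wp_seq/wp_sto => //=; first by lia.
      by rewrite D2; apply: small1; lia.
    apply/wp_asg => //=; first by apply: small; have := m_ge3; nia.
    set M := (fun i' : nat => _); set c := var s2 vc in c_le h2 h3 M *.
    have outE : out_list M (c + 1) = rcons (out_list (arr s2 0) c) (triple A j i).
      rewrite addn1 /out_list mkseqS; congr rcons.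
        apply: eq_out_list => k kc; rewrite /M /=.
        by rewrite !ifF //; apply/eqP; lia.
      rewrite /triple /M /= !eqxx /=.
      have -> : (3 * c + 2 == 3 * c + 4) = false by apply/eqP; lia.
      have -> : (3 * c + 2 == 3 * c + 3) = false by apply/eqP; lia.
      have -> : (3 * c + 3 == 3 * c + 4) = false by apply/eqP; lia.
      by rewrite i2 D2.
    split; first by lia.
    * move=> x; rewrite outE mem_rcons inE => /predU1P[->|/h2 //].
      by exists j, i; split.
    * move=> u v un v_n; rewrite before_next outE mem_rcons inE.
      case/orP => [bf e1 A1|/andP[/eqP-> /eqP->]]; last by rewrite eqxx.
      by rewrite h3 ?orbT.
    * exists b => //; split=> [/h4 H4 u v un v_n|H4].
        by rewrite before_next => /orP[|/andP[/eqP-> /eqP->]]; [exact: H4|lia].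
      by apply/h4 => u v un v_n bf; apply: H4 => //; rewrite before_next bf.
  + move=> s2 fr2; rewrite n' /=; apply: out_inv_next; first by rewrite mulSn; lia.
    by move=> u v un v_n; rewrite /before; lia.
- move=> s' fr; rewrite n_ => -[c_le h2 h3 [b okE h4]].
  have c_S : var s' vc <= n * n by lia.
  apply/wp_seq/wp_sto => //=; first by lia.
    by rewrite okE; case: (b).
  apply/wp_sto => //=; first by lia.
    by apply: small; have := m_ge3; nia.
  apply: HQ => /=.
  set M := (fun i' : nat => _).
  (* The triples start at cell 2, so the stores to cells 0 and 1 leave them intact. *)
  have outE : out_list M (var s' vc) = out_list (arr s' 0) (var s' vc).
    by apply: eq_out_list => -[|[|k]].
  by split; rewrite ?outE //; exists b.
Qed.

Lemma wp_main s (Q : state -> Prop) : var s vn = n -> arr s 0 1 = Delta ->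
  (forall u v, u < n -> v < n -> arr s 0 (u * n + v + 2) = e u v) ->
  (forall i, arr s 2 i = 0) ->
  (forall A s', parent_inv A n 0 0 ->
     out_inv A (arr s' 0) (arr s' 0 1) (arr s' 0 0) n 0 -> Q s') ->
  wpr main Q s.
Proof.
move=> n_ D_ inp A0 HQ.
apply/wp_seq/wp_asg => //=; [by lia|by rewrite D_; apply: small1; lia|].
apply/wp_seq/wp_asg => //=; first by apply: small1.
apply/wp_seq/wp_asg => //=; first by apply: small1; lia.
apply/wp_seq; apply: wp_setup_log => //= s1 fr1 L1 P1 PB1.
have n1 : var s1 vn = n by rewrite fr1.1.
have a1 : arr s1 = arr s by apply/funext => a; rewrite fr1.2.
apply/wp_seq; apply: wp_setup_copy => //=; first by rewrite a1.
move=> s2 fr2 E2.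
have cx2 : ctx s2.
  split=> //; rewrite ?[var s2 _]fr2.1 //.
  by rewrite fr1.1.
apply/wp_seq; apply: wp_parents => // [i|s3 fr3 PI].
  by rewrite fr2.2 // a1.
have cx3 : ctx s3 by apply: ctx_frame fr3 _ cx2.
apply: wp_output => // [i i_n|s4 H4]; last exact: HQ H4.
have n0 : 0 < n by case: (n) i_n.
have im : i %% n < n by rewrite ltn_mod.
have id : i %/ n < n by rewrite ltn_divLR.
by have [+ _ _] := PI _ _ id im; rewrite -divn_eq.
Qed.

End Verification.

(** * Correctness of the machine program *)

(** Commands may not assign registers 0 and 1, so the array distance is computed by hand-written
    code, which also reads n. *)
Definition prologue : program :=
  [:: Const 32 0; LoadMem 2 32; Const 33 3; Op Mul 33 33 2; Op Mul 33 33 2;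
      Op Add 33 33 2; Const 34 2; Op Add 1 33 34].

Definition tgr_program : program := prologue ++ compile (size prologue) main ++ [:: Halt].

(** At most n^2 triples after two header cells take 3n^2 + 2 cells; the input and the n + 1 jump
    positions fit too. *)
Definition stride (n : nat) : nat := 3 * (n * n) + n + 2.
Definition tgr_time (n : nat) : nat := size prologue + time (bounds n) main.
Definition tgr_space (n : nat) : nat := 6 * stride n.

Lemma tgr_time_bigO : bigO tgr_time (fun n => n ^ 3 * trunc_log 2 n).
Proof.
(* The logarithm vanishes below 2, hence the threshold; 2000 absorbs the coefficients of the step
   count. *)
exists 2000, 2 => n n2; rewrite /tgr_time /= /bounds /logb.
have l0 : 0 < trunc_log 2 n by rewrite trunc_log_gt0.
rewrite -[n ^ 3]/(n * (n * n)).
move: (trunc_log 2 n) l0 => l l0.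
set X := n * (n * n) * l.
have h1 : n * (n * n) <= X by rewrite /X leq_pmulr.
have h2 : n * n <= n * (n * n) by rewrite leq_pmull //; lia.
have h3 : n <= n * n by rewrite leq_pmull //; lia.
rewrite /X in h1 *; lia.
Qed.

Lemma tgr_space_bigO : bigO tgr_space (fun n => n ^ 2).
Proof.
exists 36, 1 => n n1; rewrite /tgr_space /stride -[n ^ 2]/(n * n).
have h3 : n <= n * n by rewrite leq_pmull.
by lia.
Qed.

Lemma nth_allpairs (T U : Type) (f : T -> U -> nat) s t x0 y0 i j :
  i < size s -> j < size t ->
  nth 0 [seq f x y | x <- s, y <- t] (i * size t + j) = f (nth x0 s i) (nth y0 t j).
Proof.
elim: s i => //= x s IH i i_s j_t; rewrite nth_cat size_map.
case: i i_s => [|i] i_s; first by rewrite mul0n add0n j_t (nth_map y0).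
by rewrite mulSn -addnA ltnNge leq_addr /= addKn IH.
Qed.

Section Output.

Variables (n : nat) (D : 'M[option nat]_n) (Delta : nat).
Hypotheses (distD : distance_matrix D) (Delta_gt0 : 0 < Delta).

Lemma ent_gt1 (u v : 'I_n) : (1 < ent D u v) = (u != v) && (0 < ent D u v).
Proof.
rewrite entE; case: eqP => [->|neq]; first by rewrite ((distD v v).2 erefl).
by case E: (D u v) => [[|d]|] //=; case: neq; apply/distD.
Qed.

(** In a realizable instance, necessity gives each pair a good w, so the exhaustive search has
    recorded one and the flag is 1. If the flag is 1, the output list satisfies the hypotheses of
    sufficiency. *)
Lemma output_correct (A M : nat -> nat) c ok :
  parent_inv n Delta (ent D) A n 0 0 ->
  out_inv n Delta (ent D) A M c ok n 0 ->
  ok = nat_of_bool `[< realizable D Delta >] /\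
  (realizable D Delta -> exists G : temporal_graph n,
     [/\ represents Delta (out_list M c) G, realization D Delta G
       & forall t0, labels_in_window G t0 Delta <= n ^ 2]).
Proof.
move=> PI [c_le L_sound L_full [b -> okP]].
have full : realizable D Delta -> forall u v, u < n -> v < n ->
    before n 0 u v -> 1 < ent D u v -> 0 < A (u * n + v).
  move=> [G GD] u v un vn _ euv; have [_ _ Aw] := PI u v un vn.
  have := @ent_gt1 (Ordinal un) (Ordinal vn); rewrite euv => /esym/andP[uv e0].
  have [w gw] := realization_good Delta_gt0 GD uv e0.
  by apply: Aw gw => //; rewrite /done vn.
(* Adding 1 to the written label gives back the residue of the encoded entry x. *)
have mod2 x : 1 < x -> ((x - 2) %% Delta + 1).+1 %% Delta = x %% Delta.
  by move=> x1; rewrite -addn1 -addnA modnDml; congr (_ %% _); lia.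
have L_ok w v t : (w, v, t) \in out_list M c ->
    [/\ w < n, v < n, w != v, 0 < t <= Delta
      & clash n Delta (ent D) v w (t.+1 %% Delta) = 0].
  move=> /L_sound[u [v' [un vn e1 A0]]] [-> -> ->].
  have [A_le Ag _] := PI u v' un vn.
  have {Ag} := Ag A0; rewrite -subn1 => /and3P[_ e_lt /eqP cl].
  rewrite mod2 //; split=> //; first by lia.
    by apply: contraTneq e_lt => ->; rewrite ltnn.
  by rewrite addn1 ltn_pmod.
have real : b -> realization D Delta (list_graph n Delta (out_list M c)).
  move=> /okP all_par; apply: list_realization => // u v uv e0.
  have e1 : 1 < ent D u v by rewrite ent_gt1 uv.
  have bf : before n 0 u v by rewrite /before ltn_ord.
  have A0 := all_par u v (ltn_ord u) (ltn_ord v) bf e1.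
  have [A_le Ag _] := PI u v (ltn_ord u) (ltn_ord v).
  have wn : A (u * n + v) - 1 < n by lia.
  have {Ag} := Ag A0; rewrite -subn1 => /and3P[e_w e_lt _].
  exists (Ordinal wn); rewrite /= e_w e_lt; split=> //.
  have := L_full u v (ltn_ord u) (ltn_ord v) bf e1 A0.
  by rewrite /triple /pmod addn1 -subn2.
split.
  case: asboolP => [/full/okP ->|nr] //.
  by case: b okP real => // _ /(_ isT) GD; case: nr; eexists; exact: GD.
move=> /full/okP bT; exists (list_graph n Delta (out_list M c)); split.
- exact: (list_represents L_ok).
- exact: real.
- move=> t0; apply: leq_trans (labels_list_graph _ _ _ _) _.
  by rewrite size_mkseq -mulnn; lia.
Qed.

End Output.

Section Program.

Variables (n : nat) (D : 'M[option nat]_n) (Delta : nat).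
Hypothesis Delta_gt0 : 0 < Delta.

Let m := magnitude D Delta.
Let S := stride n.
Variables B W H : nat.
Hypothesis B_ge4 : m * m * m * m <= B.
Hypothesis B_ge100 : 100 <= B.
Hypothesis W_ge : B ^ (2 ^ H.+2) <= W.
Hypothesis main_wf : wfC H main.
Let mem0 := memory (initial D Delta).

Lemma ent_le x y : ent D x y <= m.
Proof.
rewrite /ent; case: insubP => [v _ _|_] //=; case: insubP => [u _ _|_] //=.
rewrite /m /magnitude; case E: (D u v) => [d|] //=.
have : d <= \max_(u < n) \max_(v < n) odflt 0 (D u v).
  apply: leq_trans (leq_bigmax u); apply: leq_trans (leq_bigmax v).
  by rewrite E.
by set X := \max_(_ < _) _ => dX; rewrite addn2 ltnS (leq_trans dX) // leqW // leq_addl.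
Qed.

Lemma magnitude_ge : n + Delta + 2 <= m.
Proof. by rewrite /m /magnitude leq_add2r leq_addr. Qed.

Lemma stride_lt : S < B.
Proof.
have m3 := magnitude_ge; apply: leq_trans B_ge4; rewrite /S /stride.
have h1 : n * n <= m * m by apply: leq_mul; lia.
have h2 : m <= m * m by rewrite leq_pmull //; lia.
have h3 : 9 * (m * m) <= m * m * (m * m).
  by rewrite mulnC leq_mul2l; apply/orP; right; have : 3 * 3 <= m * m by apply: leq_mul; lia.
by rewrite -!mulnA mulnA; lia.
Qed.

(** Beyond the input the memory is 0; in array 2 this means that no last edge has been chosen
    yet. *)
Lemma mem0_ge k : n * n + 2 <= k -> mem0 k = 0.
Proof.
by move=> k_ge; rewrite /mem0 /initial [memory _]/= nth_default //= size_allpairs size_enum_ord; lia.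
Qed.

Lemma mem0_entry u v : u < n -> v < n -> mem0 (u * n + v + 2) = ent D u v.
Proof.
move=> un vn; rewrite addn2 /mem0 /= -[X in u * X](size_enum_ord n).
rewrite (nth_allpairs _ (Ordinal un) (Ordinal vn)) ?size_enum_ord //.
by rewrite -entE !nth_enum_ord.
Qed.

Lemma mem0_lt k : mem0 k < B.
Proof.
have mB : m < B := small1 Delta_gt0 magnitude_ge (erefl S) B_ge4 (leqnn m).
have m3 := magnitude_ge.
apply: leq_ltn_trans mB; case: k => [|[|k]]; rewrite /mem0 /=; try lia.
have [lt|ge] := ltnP k (n * n); last by rewrite nth_default // size_allpairs size_enum_ord.
have n0 : 0 < n by case: (n) lt.
have := @mem0_entry (k %/ n) (k %% n) _ _.
rewrite ltn_mod ltn_divLR // -divn_eq addn2 /mem0 /= => -> //.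
exact: ent_le.
Qed.

Definition state0 : state :=
  State (fun r => nth 0 [:: 0; S; n] r) (fun a i => mem0 (a * S + i)).

Lemma prologue_ok : exists c,
  [/\ run (tgr_space n) W tgr_program (size prologue) (initial D Delta) = Some c,
      pc c = size prologue & simulates S B c state0].
Proof.
have SW x : x < B * B -> x < W by apply: (BB_ltW B_ge100 stride_lt W_ge).
have BB : B <= B * B by rewrite leq_pmull //; have := B_ge100; lia.
have SB := stride_lt; have := B_ge100 => B100.
have SE : S = 3 * n * n + n + 2 by rewrite /S /stride; lia.
have M0 : 0 < tgr_space n by rewrite /tgr_space /stride; lia.
have lt x : x <= S -> x < W by move=> ?; apply: SW; lia.
have ltc x : x < 100 -> x < W by move=> ?; apply: SW; lia.
eexists; split.
- rewrite /run /= /step /= /set_reg /=.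
  rewrite ltc //= M0 /= lt /=; last by rewrite SE; lia.
  rewrite ltc //= lt /=; last by rewrite SE; nia.
  rewrite lt /=; last by rewrite SE; nia.
  rewrite lt /=; last by rewrite SE; lia.
  rewrite ltc //= lt /=; last by rewrite SE; lia.
  by [].
- by [].
- split=> //=.
  + by move=> [|[|[|r]]] rK //=; rewrite ?SE // !ifF ?nth_nil //; apply/eqP; lia.
  + by move=> [|[|[|r]]] rK //=; rewrite ?nth_nil; lia.
  + by move=> a i _ _; apply: mem0_lt.
Qed.

Lemma tgr_run : exists t c A,
  [/\ t <= tgr_time n,
      run (tgr_space n) W tgr_program t (initial D Delta) = Some c,
      halted tgr_program c, parent_inv n Delta (ent D) A n 0 0
    & out_inv n Delta (ent D) A (memory c) (memory c 1) (memory c 0) n 0].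
Proof.
have [c0 [run0 pc0 R0]] := prologue_ok.
pose Q s := exists2 A, parent_inv n Delta (ent D) A n 0 0 &
  out_inv n Delta (ent D) A (arr s 0) (arr s 0 1) (arr s 0 0) n 0.
have wpQ : wp S B (bounds n) main Q state0.
  apply: (wp_main (e := ent D) Delta_gt0 magnitude_ge (erefl S) B_ge4) => //=.
  - by move=> x y _ _; apply: ent_le.
  - by move=> u v un vn; rewrite mul0n add0n mem0_entry.
  - by move=> i; apply: mem0_ge; rewrite /S /stride; lia.
  - by move=> A s' PI OI; exists A.
have PE : tgr_program = prologue ++ compile (size prologue) main ++ [:: Halt] by [].
have [k [c [s [k_le run1 pc1 [_ memE _ _ _] [A PI [c_le h1 h2 h3]]]]]] :=
  compile_ok B_ge100 stride_lt W_ge PE pc0 R0 main_wf wpQ.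
have {}memE i : i < S -> memory c i = arr s 0 i.
  by move=> iS; rewrite -memE // mul0n add0n.
have S2 : 3 * (n * n) + 2 <= S by rewrite /S /stride; lia.
have outE : out_list (memory c) (arr s 0 1) = out_list (arr s 0) (arr s 0 1).
  by apply: eq_out_list => i i_c; apply: memE; lia.
exists (size prologue + k), c, A; split.
- by rewrite /tgr_time leq_add2l.
- exact: run_add run0 run1.
- rewrite /halted PE pc1 catA -size_cat; exact: onth_at.
- exact: PI.
- by rewrite !memE; [split; rewrite ?outE|lia|lia].
Qed.

End Program.

(** The stored values are bounded by [B], the fifth power of the magnitude: the magnitude is at
    least 3, and 3^5 exceeds 100 while 3^4 does not. The deepest expression, the comparison in
    [sort_column], has height 6, and [W_ge] asks for two more levels; this gives the exponent 5 *
    2^8. *)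
Lemma tgr_computes n (D : 'M[option nat]_n) (Delta : nat) :
  distance_matrix D -> 0 < Delta ->
  computes tgr_program (5 * 2 ^ 8) (tgr_time n) (tgr_space n) D Delta
    (fun m => m 0 = nat_of_bool `[< realizable D Delta >] /\
       (realizable D Delta -> exists G : temporal_graph n,
          [/\ represents Delta (output_list m) G, realization D Delta G
            & forall t0, labels_in_window G t0 Delta <= n ^ 2])).
Proof.
move=> distD Delta_gt0.
have m_ge := magnitude_ge D Delta.
have m3 : 3 <= magnitude D Delta by lia.
have B4 : magnitude D Delta * magnitude D Delta * magnitude D Delta *
    magnitude D Delta <= magnitude D Delta ^ 5.
  by rewrite !expnS expn0 muln1 !mulnA leq_pmulr //; lia.
have B100 : 100 <= magnitude D Delta ^ 5.
  by apply: (@leq_trans (3 ^ 5)) => //; rewrite leq_exp2r.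
have W_ge : (magnitude D Delta ^ 5) ^ (2 ^ 6.+2) <=
    magnitude D Delta ^ (5 * 2 ^ 8) by rewrite -expnM.
have main_wf : wfC 6 main by [].
have [t [c [A [t_le run_c halt_c PI OI]]]] :=
  tgr_run Delta_gt0 B4 B100 W_ge main_wf.
exists t, c; split=> //; exact: output_correct PI OI.
Qed.

Theorem theorem3p13 :
  (exists (P : program) (k : nat) (T M : nat -> nat),
     [/\ bigO T (fun n => n ^ 3 * trunc_log 2 n),
         bigO M (fun n => n ^ 2)
       & forall (n : nat) (D : 'M[option nat]_n) (Delta : nat),
           distance_matrix D -> 0 < Delta ->
           computes P k (T n) (M n) D Delta
             (fun m => m 0 = nat_of_bool `[< realizable D Delta >])]) /\
  (exists (P : program) (k : nat) (T M : nat -> nat),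
     [/\ bigO T (fun n => n ^ 3 * trunc_log 2 n),
         bigO M (fun n => n ^ 2)
       & forall (n : nat) (D : 'M[option nat]_n) (Delta : nat),
           distance_matrix D -> 0 < Delta -> realizable D Delta ->
           computes P k (T n) (M n) D Delta
             (fun m => exists G : temporal_graph n,
                [/\ represents Delta (output_list m) G,
                    realization D Delta G
                  & forall t0, labels_in_window G t0 Delta <= n ^ 2])]).
Proof.
split; exists tgr_program, (5 * 2 ^ 8), tgr_time, tgr_space;
  (split; [exact: tgr_time_bigO|exact: tgr_space_bigO|]).
- move=> n D Delta distD D0.
  by have [t [c [? ? ? []]]] := tgr_computes distD D0; exists t, c.
- move=> n D Delta distD D0 DR.
  by have [t [c [? ? ? [_ /(_ DR)]]]] := tgr_computes distD D0; exists t, c.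
Qed.
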